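(* Let $\Gamma$ be a finite connected graph and let $\lambda\in A(\Gamma)$ be a loxodromic element. Then there exists a unique pair of points $p^{\pm}$ in the boundary $\partial\Gamma^e$ such that for any compact subset $K\subseteq\partial\Gamma^e\setminus\{p^-\}$ and for any open subset $U\subseteq\partial\Gamma^e$ containing $p^+$, there exists a positive integer $N$ such that $\lambda^N(K)\subseteq U$. Furthermore, if $\lambda'\in A(\Gamma)$ is another loxodromic element which shares no common nonzero power with $\lambda$, then no fixed boundary point of $\lambda$ coincides with any fixed boundary point of $\lambda'$.
   Context: Graphs are simplicial. $A(\Gamma)=\langle V(\Gamma)\mid [a,b]=1 \text{ for each } \{a,b\}\in E(\Gamma)\rangle$. The extension graph $\Gamma^e$ has vertex set $\{v^g : v\in V(\Gamma), g\in A(\Gamma)\}$, $v^g=g^{-1}vg$, with two distinct vertices adjacent iff they commute in $A(\Gamma)$; it carries the graph metric $d$, and $A(\Gamma)$ acts by conjugation $v^h\mapsto v^{hg}$. For $\Gamma$ connected, $\Gamma^e$ is a quasi-tree, hence Gromov hyperbolic; $\partial\Gamma^e$ is its Gromov boundary with the usual topology, on which $A(\Gamma)$ acts by homeomorphisms. An element $g\in A(\Gamma)$ is loxodromic if $\lim_{n\to\infty}\frac1n d(x,x^{g^n})>0$ for $x\in\Gamma^e$. Sharing no common nonzero power means $\lambda^m\ne(\lambda')^n$ for all nonzero integers $m,n$. *)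

(* Defs.v *)
From HB Require Import structures.
From mathcomp Require Import all_boot all_order all_algebra.
From mathcomp Require Import generic_quotient.
From mathcomp Require Import all_classical all_reals all_analysis.
Set Implicit Arguments.
Unset Strict Implicit.
Unset Printing Implicit Defensive.
Import Order.TTheory GRing.Theory Num.Theory.
Import numFieldNormedType.Exports.
Local Open Scope classical_set_scope.
Local Open Scope ring_scope.
Local Open Scope quotient_scope.

Section Graph.
Context {V : finType}.

Definition simple_graph (e : rel V) := symmetric e /\ irreflexive e.

(* The null graph does not count as connected. *)
Definition connected_graph (e : rel V) :=
  (0 < #|V|)%N /\ forall a b : V, connect e a b.

End Graph.

(* The group A(e) presented by generators V and relators [a, b] for e a b.    *)
(* A word is a sequence of letters: (v, true) is v and (v, false) is v^-1.    *)
Section RightAngledArtinGroup.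
Context {V : finType}.
Variable e : rel V.

Definition word := seq (V * bool).

Definition inv_letter (x : V * bool) := (x.1, ~~ x.2).

Definition inv_word (w : word) : word := rev (map inv_letter w).

Inductive word_eq : word -> word -> Prop :=
| word_eq_refl w : word_eq w w
| word_eq_sym w1 w2 : word_eq w1 w2 -> word_eq w2 w1
| word_eq_trans w1 w2 w3 : word_eq w1 w2 -> word_eq w2 w3 -> word_eq w1 w3
| word_eq_cat w1 w2 w1' w2' :
    word_eq w1 w1' -> word_eq w2 w2' -> word_eq (w1 ++ w2) (w1' ++ w2')
| word_eq_cancel x : word_eq [:: x; inv_letter x] [::]
| word_eq_commutator a b : e a b ->
    word_eq [:: (a, false); (b, false); (a, true); (b, true)] [::].

Definition word_eqb : rel word := fun w1 w2 => `[< word_eq w1 w2 >].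

Lemma word_eqb_refl : reflexive word_eqb.
Proof. by move=> w; apply/asboolP; exact: word_eq_refl. Qed.

Lemma word_eqb_sym : symmetric word_eqb.
Proof. by move=> w1 w2; apply/asboolP/asboolP; exact: word_eq_sym. Qed.

Lemma word_eqb_trans : transitive word_eqb.
Proof.
by move=> w2 w1 w3 /asboolP h1 /asboolP h2; apply/asboolP; exact: word_eq_trans h2.
Qed.

Canonical word_eqb_equiv :=
  EquivRel word_eqb word_eqb_refl word_eqb_sym word_eqb_trans.

Definition raag := {eq_quot word_eqb}.

HB.instance Definition _ := Choice.on raag.
HB.instance Definition _ := EqQuotient.on raag.

Definition raag_mul (g h : raag) : raag := \pi_raag (repr g ++ repr h).
Definition raag_one : raag := \pi_raag [::].
Definition raag_inv (g : raag) : raag := \pi_raag (inv_word (repr g)).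

Definition raag_gen (v : V) : raag := \pi_raag [:: (v, true)].

Lemma raag_piP w1 w2 : \pi_raag w1 = \pi_raag w2 <-> word_eq w1 w2.
Proof.
split=> [/eqmodP/asboolP//|h]; by apply/eqmodP/asboolP.
Qed.

Lemma word_eq_repr w : word_eq (repr (\pi_raag w)) w.
Proof. by apply/raag_piP; rewrite reprK. Qed.

Lemma inv_letterK : involutive inv_letter.
Proof. by case=> v b; rewrite /inv_letter /= negbK. Qed.

Lemma word_eq_invl w : word_eq (inv_word w ++ w) [::].
Proof.
elim: w => [|x w IHw]; first exact: word_eq_refl.
rewrite /inv_word /= rev_cons -cats1 -catA -/(inv_word w) /=.
apply: word_eq_trans IHw; apply: word_eq_cat; first exact: word_eq_refl.
rewrite -[X in word_eq _ X]cat0s -[_ :: _]/([:: inv_letter x; x] ++ w).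
apply: word_eq_cat; last exact: word_eq_refl.
by rewrite -[X in [:: _; X]]inv_letterK; exact: word_eq_cancel.
Qed.

Lemma inv_wordK : involutive inv_word.
Proof.
move=> w; rewrite /inv_word map_rev revK -map_comp -[RHS]map_id.
by apply: eq_map => x /=; exact: inv_letterK.
Qed.

Lemma raag_mulA : associative raag_mul.
Proof.
move=> g h k; apply/raag_piP.
apply: word_eq_trans (word_eq_cat (word_eq_refl _) (word_eq_repr _)) _.
rewrite catA; apply: word_eq_cat; last exact: word_eq_refl.
exact/word_eq_sym/word_eq_repr.
Qed.

Lemma raag_mul1g : left_id raag_one raag_mul.
Proof.
move=> g; rewrite -[RHS]reprK; apply/raag_piP.
by apply: word_eq_cat (word_eq_repr [::]) (word_eq_refl _).
Qed.

Lemma raag_mulg1 : right_id raag_one raag_mul.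
Proof.
move=> g; rewrite -[RHS]reprK; apply/raag_piP.
rewrite -[X in word_eq _ X]cats0.
exact: word_eq_cat (word_eq_refl _) (word_eq_repr [::]).
Qed.

Lemma raag_mulVg : left_inverse raag_one raag_inv raag_mul.
Proof.
move=> g; apply/raag_piP; apply: word_eq_trans (word_eq_invl (repr g)).
exact: word_eq_cat (word_eq_repr _) (word_eq_refl _).
Qed.

Lemma raag_mulgV : right_inverse raag_one raag_inv raag_mul.
Proof.
move=> g; apply/raag_piP.
apply: word_eq_trans (word_eq_invl (inv_word (repr g))).
rewrite inv_wordK; exact: word_eq_cat (word_eq_refl _) (word_eq_repr _).
Qed.

HB.instance Definition _ :=
  isGroup.Build raag raag_mulA raag_mul1g raag_mulg1 raag_mulVg raag_mulgV.

End RightAngledArtinGroup.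

Definition expgz (G : groupType) (x : G) (m : int) : G :=
  match m with
  | Posz n => (x ^+ n)%g
  | Negz n => (x ^- n.+1)%g
  end.

Section GraphMetric.
Context {T : eqType}.
Variable r : rel T.

Definition has_walk (x y : T) (n : nat) : Prop :=
  exists p : seq T, [/\ path r x p, last x p = y & size p = n].

(* The value is 0 when x and y lie in different components. *)
Definition graph_dist (x y : T) : nat :=
  if pselect (exists n, `[< has_walk x y n >]) is left h then ex_minn h else 0%N.

End GraphMetric.

(* The sequential Gromov boundary, which does not require T to be proper. In  *)
(* a metric space the conditions below do not depend on the base point o, and *)
(* in a hyperbolic one boundary_equiv is an equivalence relation on the       *)
(* sequences that converge at infinity; boundary points are its classes.      *)
Section GromovBoundary.
Context {R : realType} {T : Type}.
Variable d : T -> T -> R.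

Definition gromov_product (o x y : T) : R := (d o x + d o y - d x y) / 2.

Definition liminf_product (o : T) (u v : nat -> T) : \bar R :=
  limf_einf (fun ij : nat * nat => (gromov_product o (u ij.1) (v ij.2))%:E)
    (filter_prod \oo \oo).

Definition cvg_at_infinity (u : nat -> T) :=
  forall o, liminf_product o u u = +oo%E.

Definition boundary_equiv (u v : nat -> T) :=
  forall o, liminf_product o u v = +oo%E.

Definition boundary_class (u : nat -> T) : set (nat -> T) :=
  [set v | cvg_at_infinity v /\ boundary_equiv u v].

Definition gromov_boundary :=
  {S : set (nat -> T) | exists2 u, cvg_at_infinity u & S = boundary_class u}.

HB.instance Definition _ := gen_eqMixin gromov_boundary.
HB.instance Definition _ := gen_choiceMixin gromov_boundary.

(* sval p is the set of sequences that converge to p. *)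
Definition boundary_ball (o : T) (p : gromov_boundary) (s : R) :
    set gromov_boundary :=
  [set q | exists u v, [/\ sval p u, sval q v &
                           (s%:E <= liminf_product o u v)%E]].

Definition boundary_open : set (set gromov_boundary) :=
  [set U | forall p, U p -> forall o, exists s, boundary_ball o p s `<=` U].

Lemma boundary_openT : boundary_open setT.
Proof. by move=> p _ o; exists 0. Qed.

Lemma boundary_openI : setI_closed boundary_open.
Proof.
move=> A B oA oB p [Ap Bp] o.
have [s sA] := oA p Ap o; have [t tB] := oB p Bp o.
exists (Num.max s t) => q [u [v [pu qv h]]]; split.
- by apply: sA; exists u, v; split=> //; apply: le_trans h; rewrite lee_fin le_max lexx.
- apply: tB; exists u, v; split=> //; apply: le_trans h.
  by rewrite lee_fin le_max lexx orbT.
Qed.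

Lemma boundary_open_bigcup (I : Type) (f : I -> set gromov_boundary) :
  (forall i, boundary_open (f i)) -> boundary_open (\bigcup_i f i).
Proof.
move=> of_ p [i _ fip] o; have [s sf] := of_ i p fip o.
by exists s => q /sf fq; exists i.
Qed.

HB.instance Definition _ := isOpenTopological.Build gromov_boundary
  boundary_openT boundary_openI boundary_open_bigcup.

Section Action.
Variables f f' : T -> T.
Hypothesis f'K : cancel f' f.
Hypothesis f_isom : forall x y, d (f x) (f y) = d x y.

Lemma liminf_product_isom o u v :
  liminf_product (f o) (f \o u) (f \o v) = liminf_product o u v.
Proof. by rewrite /liminf_product /gromov_product /=; under eq_fun do rewrite !f_isom. Qed.

Lemma cvg_at_infinity_isom u : cvg_at_infinity (f \o u) <-> cvg_at_infinity u.
Proof.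
split=> h o; first by rewrite -liminf_product_isom.
by rewrite -(f'K o) liminf_product_isom.
Qed.

Lemma boundary_equiv_isom u v :
  boundary_equiv (f \o u) (f \o v) <-> boundary_equiv u v.
Proof.
split=> h o; first by rewrite -liminf_product_isom.
by rewrite -(f'K o) liminf_product_isom.
Qed.

Lemma boundary_image_subproof (p : gromov_boundary) :
  exists2 u, cvg_at_infinity u &
    [set f \o v | v in sval p] = boundary_class u.
Proof.
case: p => _ /= [u cu ->]; exists (f \o u); first exact/cvg_at_infinity_isom.
apply/seteqP; split=> [_ [v [cv uv] <-]|w [cw uw]] /=.
  by split; [apply/cvg_at_infinity_isom|apply/boundary_equiv_isom].
have fw : f \o (f' \o w) = w by apply/funext => n /=; rewrite f'K.
exists (f' \o w) => //; rewrite -fw in cw uw.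
by split; [apply/cvg_at_infinity_isom|apply/boundary_equiv_isom].
Qed.

Definition boundary_image (p : gromov_boundary) : gromov_boundary :=
  exist _ _ (boundary_image_subproof p).

End Action.
End GromovBoundary.

Section ExtensionGraph.
Context {V : finType}.
Variable e : rel V.

Definition is_vertex_conj (x : raag e) : bool :=
  `[< exists v g, x = (raag_gen e v ^ g)%g >].

Definition ext_vertex := {x : raag e | is_vertex_conj x}.

HB.instance Definition _ := Choice.on ext_vertex.

Definition ext_adj : rel ext_vertex :=
  fun x y => (x != y) && (val x * val y == val y * val x)%g.

Lemma is_vertex_conjJ (x : ext_vertex) (g : raag e) :
  is_vertex_conj (val x ^ g)%g.
Proof.
case: x => x /= /asboolP[v [h ->]]; apply/asboolP.
by exists v, (h * g)%g; rewrite conjgM.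
Qed.

(* A right action: ext_conj (g * h) is ext_conj h after ext_conj g. *)
Definition ext_conj (g : raag e) (x : ext_vertex) : ext_vertex :=
  Sub (val x ^ g)%g (is_vertex_conjJ x g).

Definition ext_dist : ext_vertex -> ext_vertex -> nat := graph_dist ext_adj.

Lemma ext_conjK g : cancel (ext_conj g) (ext_conj g^-1%g).
Proof. by move=> x; apply: val_inj; rewrite /= conjgK. Qed.

Lemma ext_conjKV g : cancel (ext_conj g^-1%g) (ext_conj g).
Proof. by move=> x; apply: val_inj; rewrite /= conjgKV. Qed.

Lemma ext_adjJ g x y : ext_adj (ext_conj g x) (ext_conj g y) = ext_adj x y.
Proof.
rewrite /ext_adj (can_eq (ext_conjK g)) /=; congr andb.
by rewrite -!conjMg (can_eq (conjgK g)).
Qed.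

Lemma has_walkJ g x y n :
  has_walk ext_adj x y n -> has_walk ext_adj (ext_conj g x) (ext_conj g y) n.
Proof.
move=> [p [xp <- <-]]; exists (map (ext_conj g) p).
rewrite last_map size_map path_map; split=> //.
by rewrite (eq_path (e' := ext_adj))// => ? ?; exact: ext_adjJ.
Qed.

Lemma ext_distJ g x y : ext_dist (ext_conj g x) (ext_conj g y) = ext_dist x y.
Proof.
have E : has_walk ext_adj (ext_conj g x) (ext_conj g y) = has_walk ext_adj x y.
  apply/funext => n; apply/propext; split; last exact: has_walkJ.
  by move/(has_walkJ g^-1%g); rewrite !ext_conjK.
by rewrite /ext_dist /graph_dist E.
Qed.

Definition ext_distR (R : realType) (x y : ext_vertex) : R := (ext_dist x y)%:R.

Definition ext_boundary (R : realType) := gromov_boundary (@ext_distR R).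

HB.instance Definition _ R := Topological.on (ext_boundary R).

Lemma ext_distRJ (R : realType) g x y :
  ext_distR R (ext_conj g x) (ext_conj g y) = ext_distR R x y.
Proof. by rewrite /ext_distR ext_distJ. Qed.

Definition boundary_act (R : realType) (g : raag e) :
    ext_boundary R -> ext_boundary R :=
  boundary_image (ext_conjKV g) (@ext_distRJ R g).

Definition loxodromic (R : realType) (g : raag e) :=
  forall x : ext_vertex, exists2 l : R, 0 < l &
    ((ext_dist x (ext_conj (g ^+ n)%g x))%:R / n%:R : R) @[n --> \oo] --> l.

Definition attracting_repelling (R : realType) (g : raag e)
    (pp pm : ext_boundary R) :=
  forall K U : set (ext_boundary R),
    compact K -> K `<=` ~` [set pm] -> open U -> U pp ->
    exists2 N : nat, (0 < N)%N & boundary_act (g ^+ N)%g @` K `<=` U.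

End ExtensionGraph.

(* Main.v *)
Require Import Defs.
From mathcomp Require Import all_boot all_order all_algebra.
From mathcomp Require Import generic_quotient zify lra.
From mathcomp Require Import all_classical all_reals all_analysis.
Set Implicit Arguments.
Unset Strict Implicit.
Unset Printing Implicit Defensive.
Import Order.TTheory GRing.Theory Num.Theory.

(** Why the theorem holds.

    Fix a vertex v0. Write len for the word length of the group A of the graph,
    call a product reduced when lengths add up, and let slen g be the distance
    from v0 to v0 ^ g in the extension graph. Walks in the extension graph are
    products of elements of star subgroups, taken along walks in the defining
    graph, because two commuting conjugates of generators lie in one translate of
    the defining graph (conj_comm_star).

    Hyperbolicity comes from two facts about reduced words. First, two suffixes of
    one element that have no common last letter commute letter by letter
    (suffix_orth); when both are nontrivial, each lies in the star of a vertex,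
    so it is short for slen. Second, slen is additive up to a constant along
    reduced products (rstar_path_split, slen_rprod). By the second fact the Gromov
    product of v0 ^ g and v0 ^ h at v0 is, up to a constant, the length of the
    longest common suffix of g and h; by the first, two suffixes of h are nearly
    comparable. The four-point inequality follows (ext_four_points).

    The powers of a loxodromic element are cyclically reduced up to conjugation,
    so the additivity of slen makes its orbits quasi-geodesics without any local
    to global principle (slen_pow_add). The classical computation with Gromov
    products then gives the north-south dynamics on the sequential boundary
    (attract, north_south), and the boundary is regular enough to deduce that the
    two poles are the only fixed points and, given a third boundary point, that
    the pair of poles is the only one with the dynamics (poles_unique).

    For two elements g and h with a common fixed boundary point, acylindricity
    is replaced by a counting argument on words. Let h fix the limit of the
    points v0 ^ (g ^+ n), with g cyclically reduced. For all i and all large k the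
    element g ^+ k * h ^+ i is a suffix of a power of g (same_end_suffix); it is
    b * g ^+ j with b not ending with g. As the support of g is not a join, there
    are only finitely many such b (suffix_pow_short). Two exponents i with the
    same b give a common power of g and h (same_end_power). The same statement,
    for h a power of a generator, yields the third boundary point. *)

(** * Reduced words *)

Section RightAngledArtinGroups.
Local Open Scope quotient_scope.
Local Open Scope group_scope.
Context {V : finType} {e : rel V} (e_simple : simple_graph e).
Implicit Types (x y z : V * bool) (v u : V).

Let G := raag e.
Implicit Types (g h a b c s t : G).

Lemma adjC u v : e u v = e v u. Proof. exact: (proj1 e_simple). Qed.
Lemma adjxx v : e v v = false. Proof. exact: (proj2 e_simple). Qed.

Definition of_word w : G := \pi_(raag e) w.
Definition letter x : G := of_word [:: x].

Lemma of_wordP w1 w2 : of_word w1 = of_word w2 <-> word_eq e w1 w2.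
Proof. exact: raag_piP. Qed.

Lemma of_word_repr g : of_word (repr g) = g.
Proof. exact: reprK. Qed.

Lemma of_word_cat w1 w2 : of_word (w1 ++ w2) = of_word w1 * of_word w2.
Proof.
by apply/of_wordP; apply: word_eq_sym; apply: word_eq_cat; exact: word_eq_repr.
Qed.

Lemma of_word_nil : of_word [::] = 1.
Proof. by []. Qed.

Lemma of_word_rcons w x : of_word (rcons w x) = of_word w * letter x.
Proof. by rewrite -cats1 of_word_cat. Qed.

Lemma of_word_cons w x : of_word (x :: w) = letter x * of_word w.
Proof. by rewrite -cat1s of_word_cat. Qed.

Lemma of_word_ind (P : G -> Prop) :
  P 1 -> (forall g x, P g -> P (g * letter x)) -> forall g, P g.
Proof.
move=> P1 PS g; rewrite -(of_word_repr g).
by elim/last_ind: (repr g) => // w x IH; rewrite of_word_rcons; exact: PS.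
Qed.

Lemma letterV x : letter (inv_letter x) = (letter x)^-1.
Proof.
apply/esym/mulg1_eq; rewrite -of_word_cat -of_word_nil.
by apply/of_wordP; exact: word_eq_cancel.
Qed.

Lemma letterC x y : e x.1 y.1 -> letter x * letter y = letter y * letter x.
Proof.
suff C (a b : V) : e a b -> letter (a, true) * letter (b, true) =
                      letter (b, true) * letter (a, true).
  move=> exy; have : commute (letter (x.1, true)) (letter (y.1, true)) by exact: C.
  have E z : letter z = if z.2 then letter (z.1, true) else (letter (z.1, true))^-1.
    by case: z => z [] //=; rewrite -letterV.
  rewrite (E x) (E y) => cxy; case: x.2; case: y.2 => //.
  - exact: commuteV.
  - exact/commute_sym/commuteV/commute_sym.
  - by apply/commute_sym/commuteV/commute_sym/commuteV.
move=> eab.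
have : of_word [:: (a, false); (b, false); (a, true); (b, true)] = 1.
  by rewrite -of_word_nil; apply/of_wordP; exact: word_eq_commutator.
rewrite !of_word_cons of_word_nil mulg1.
rewrite -[(a, false)]/(inv_letter (a, true)) -[(b, false)]/(inv_letter (b, true)).
rewrite !letterV => H; have : commute (letter (a, true)) (letter (b, true)).
  apply: (mulgI (letter (b, true))^-1); apply: (mulgI (letter (a, true))^-1).
  by rewrite H mulKg mulVg.
by [].
Qed.

(** A pile has one stack per vertex. The letter (v, b) puts the sign b on the
    stack of v and a blank None on the stack of every other vertex that is not
    adjacent to v, unless the opposite sign is on top of the stack of v: then
    it takes away what that sign came with. Whether a letter can be cancelled
    at the end of a word is thus visible on one stack. *)
Definition pile := V -> seq (option bool).
Definition cancels (P : pile) x := ohead (P x.1) == Some (Some (~~ x.2)).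
Definition push (P : pile) x : pile := fun u =>
  if e u x.1 then P u else (if u == x.1 then Some x.2 else None) :: P u.
Definition pop (P : pile) x : pile := fun u => if e u x.1 then P u else behead (P u).
Definition act P x := if cancels P x then pop P x else push P x.
Definition empty_pile : pile := fun _ => [::].
Definition pile_of w := foldl act empty_pile w.

(** The piles that arise without cancellation, each with the element that it
    represents. The laws of act fail for arbitrary families of stacks, and are
    proved by induction on this predicate. *)
Inductive piled : G -> pile -> Prop :=
| piled1 : piled 1 empty_pile
| piledM g P x : piled g P -> ~~ cancels P x -> piled (g * letter x) (push P x).

Lemma cancels_push P x y : e x.1 y.1 -> cancels (push P y) x = cancels P x.
Proof. by move=> exy; rewrite /cancels /push exy. Qed.

Lemma cancels_pop P x y : e x.1 y.1 -> cancels (pop P y) x = cancels P x.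
Proof. by move=> exy; rewrite /cancels /pop exy. Qed.

Lemma cancels_act P x y : e x.1 y.1 -> cancels (act P y) x = cancels P x.
Proof. by move=> exy; rewrite /act; case: ifP; rewrite ?cancels_push ?cancels_pop. Qed.

Lemma cancels_pushN P x y :
  cancels (push P y) x -> x <> inv_letter y -> e x.1 y.1.
Proof.
case: x y => [x b] [y c]; rewrite /cancels /push /=; case: ifP => // _.
case: (eqVneq x y) => [->|//] /= /eqP[->] [].
by rewrite /inv_letter /= negbK.
Qed.

(** The letters that come after the one on top of the stack of x.1 are adjacent
    to x.1. On the stack of a vertex u that is not adjacent to x.1, they put
    blanks only, as that letter did. *)
Lemma piled_top g P x u : piled g P -> cancels P x -> u != x.1 -> ~~ e u x.1 ->
  ohead (P u) = Some None.
Proof.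
move=> gP; elim: gP x u => [|{}g {}P y gP IH ncy] x u; first by [].
move=> cx ux eux; case: (eqVneq x (inv_letter y)) => [xy|xy].
  rewrite /push; move: ux eux; rewrite xy /= => /negbTE-> /negbTE->.
  by [].
have exy : e x.1 y.1 by apply: cancels_pushN cx _; apply/eqP.
rewrite cancels_push // in cx.
rewrite /push; case: ifP => [euy|euy]; first exact: (IH x).
by case: eqP => // uy; rewrite adjC uy exy in eux.
Qed.

Lemma push_popC P x y g : piled g P -> cancels P x -> e x.1 y.1 ->
  pop (push P y) x = push (pop P x) y.
Proof.
move=> gP cx exy; apply/funext => u; rewrite /pop /push.
case: ifP => // eux; case: ifP => // euy; case: eqP => [uy|_].
  by rewrite uy adjC exy in eux.
case: (eqVneq u x.1) => [ux|ux]; first by rewrite -ux euy in exy.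
by have := piled_top gP cx ux (negbT eux); case: (P u) => //= a s [->].
Qed.

Lemma pushKpop P x : pop (push P x) (inv_letter x) = P.
Proof. by apply/funext => u; rewrite /pop /push /=; case: ifP => // ->. Qed.

(** The letter that x cancels commutes with all the later ones, so it can be
    deleted from the place where it was put. *)
Lemma piled_pop g P x : piled g P -> cancels P x -> piled (g * letter x) (pop P x).
Proof.
move=> gP; elim: gP x => [|{}g {}P y gP IH ncy] x; first by [].
move=> cx; case: (eqVneq x (inv_letter y)) => [->|/eqP xy].
  by rewrite pushKpop letterV mulgK.
have exy := cancels_pushN cx xy; rewrite cancels_push // in cx.
rewrite (push_popC gP) // -mulgA letterC 1?adjC // mulgA.
by apply: piledM; [exact: IH | rewrite cancels_pop // adjC].
Qed.

Lemma piled_act g P x : piled g P -> piled (g * letter x) (act P x).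
Proof.
by move=> gP; rewrite /act; case: ifP => cx; [exact: piled_pop | apply: piledM; rewrite ?cx].
Qed.

Lemma piled_word w g P : piled g P -> piled (g * of_word w) (foldl act P w).
Proof.
elim: w g P => [|x w IH] g P gP /=; first by rewrite of_word_nil mulg1.
by rewrite of_word_cons mulgA; apply: IH; exact: piled_act.
Qed.

Lemma cancels_popV g P x : piled g P -> cancels P x ->
  ~~ cancels (pop P x) (inv_letter x).
Proof.
move=> gP; elim: gP x => [|{}g {}P y gP IH ncy] x; first by [].
move=> cx; case: (eqVneq x (inv_letter y)) => [->|/eqP xy].
  by rewrite pushKpop inv_letterK.
have exy := cancels_pushN cx xy; rewrite cancels_push // in cx.
by rewrite (push_popC gP) // cancels_push //; exact: IH.
Qed.

Lemma popKpush g P x : piled g P -> cancels P x -> push (pop P x) (inv_letter x) = P.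
Proof.
move=> gP cx; apply/funext => u; rewrite /pop /push /=.
case: ifP => [-> //|eux]; rewrite ?eux; case: (eqVneq u x.1) => [ux|ux].
  by move: cx; rewrite /cancels -ux; case: (P u) => //= a s /eqP[->].
by have := piled_top gP cx ux (negbT eux); case: (P u) => //= a s [->].
Qed.

Lemma actK g P x : piled g P -> act (act P x) (inv_letter x) = P.
Proof.
move=> gP; rewrite {2}/act; case: ifP => cx.
  by rewrite /act ifN ?(popKpush gP) //; exact: cancels_popV gP cx.
rewrite /act ifT ?pushKpop // /cancels /push /= adjxx eqxx /=.
by rewrite negbK.
Qed.

Lemma pushC P x y : e x.1 y.1 -> push (push P y) x = push (push P x) y.
Proof.
move=> exy; apply/funext => u; rewrite /push.
case eux: (e u x.1); case euy: (e u y.1) => //.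
case: (eqVneq u x.1) => [ux|_]; first by rewrite -ux euy in exy.
by case: (eqVneq u y.1) => // uy; rewrite uy adjC exy in eux.
Qed.

Lemma popC P x y : e x.1 y.1 -> pop (pop P y) x = pop (pop P x) y.
Proof. by move=> exy; apply/funext => u; rewrite /pop; case: (e u x.1); case: (e u y.1). Qed.

Lemma actC g P x y : piled g P -> e x.1 y.1 -> act (act P y) x = act (act P x) y.
Proof.
move=> gP exy; have eyx : e y.1 x.1 by rewrite adjC.
rewrite {1}/act (cancels_act _ exy) [RHS]/act (cancels_act _ eyx) /act.
case: ifP => cx; case: ifP => cy.
- exact: popC.
- exact: push_popC gP _ _.
- by rewrite (push_popC gP).
- exact: pushC.
Qed.

(** The relators act trivially, so the pile of a word is an invariant of the
    group element. This solves the word problem. *)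
Lemma foldl_act_eq w1 w2 : word_eq e w1 w2 ->
  forall g P, piled g P -> foldl act P w1 = foldl act P w2.
Proof.
elim=> {w1 w2} [//|w1 w2 _ IH|w1 w2 w3 _ IH1 _ IH2|w1 w2 w1' w2' _ IH1 _ IH2|x|a b eab]
  g P gP.
- by rewrite (IH g).
- by rewrite (IH1 g) // (IH2 g).
- by rewrite !foldl_cat (IH1 g) // (IH2 (g * of_word w1')) //; exact: piled_word.
- by rewrite /= (actK _ gP).
- rewrite /=; have gb := piled_act (b, false) (piled_act (a, false) gP).
  rewrite (actC (x := (b, true)) gb) 1?adjC //= -[(b, true)]/(inv_letter (b, false)).
  rewrite (actK _ (piled_act (a, false) gP)) -[(a, true)]/(inv_letter (a, false)).
  exact: actK gP.
Qed.

Definition pile_elt g := pile_of (repr g).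

Lemma pile_of_word w : pile_elt (of_word w) = pile_of w.
Proof.
by apply: (foldl_act_eq _ piled1); apply/of_wordP; rewrite of_word_repr.
Qed.

Lemma piled_elt g : piled g (pile_elt g).
Proof. by have := piled_word (repr g) piled1; rewrite of_word_repr mul1g. Qed.

Lemma pile_eltM g x : pile_elt (g * letter x) = act (pile_elt g) x.
Proof.
rewrite -{1}(of_word_repr g) -of_word_rcons pile_of_word /pile_of foldl_rcons.
by [].
Qed.

Lemma piled_uniq g P : piled g P -> P = pile_elt g.
Proof.
elim=> [|{}g {}P x gP -> ncx]; last first.
  by rewrite pile_eltM /act; case: ifP => // cx; rewrite cx in ncx.
by rewrite -of_word_nil pile_of_word.
Qed.

(** That x is the last letter of some reduced word for g. *)
Definition last_letter g x := cancels (pile_elt g) (inv_letter x).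

(** The number of letters at v in any reduced word for g (reduced_word). *)
Definition occ v g := count isSome (pile_elt g v).
Definition len g := \sum_v occ v g.

Lemma last_mul g x : ~~ last_letter g (inv_letter x) -> last_letter (g * letter x) x.
Proof.
rewrite /last_letter inv_letterK => ncx; rewrite pile_eltM /act (negbTE ncx).
by rewrite /cancels /push /= adjxx eqxx /= negbK.
Qed.

Lemma reduced_ind (Q : G -> Prop) : Q 1 ->
  (forall g x, ~~ last_letter g (inv_letter x) -> Q g -> Q (g * letter x)) ->
  forall g, Q g.
Proof.
move=> Q1 QS g; elim: (piled_elt g) => // {}g P x gP Qg ncx.
by apply: QS => //; rewrite /last_letter inv_letterK -(piled_uniq gP).
Qed.

Lemma occ_push v g x : ~~ last_letter g (inv_letter x) ->
  occ v (g * letter x) = (occ v g + (v == x.1))%N.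
Proof.
rewrite /last_letter inv_letterK => ncx; rewrite /occ pile_eltM /act (negbTE ncx).
rewrite /push; case: ifP => [evx|_ /=]; last by rewrite addnC; case: eqP.
by case: eqP => [E|_]; rewrite ?addn0 //; rewrite E adjxx in evx.
Qed.

Lemma occ1 v : occ v 1 = 0%N.
Proof. by rewrite /occ -(piled_uniq piled1). Qed.

Lemma len1 : len 1 = 0%N.
Proof. by rewrite /len big1 // => v _; exact: occ1. Qed.

Lemma sum_pred1 v : (\sum_u (u == v) = 1)%N.
Proof.
rewrite (bigD1 v) //= eqxx big1 // => u /negbTE ->.
by [].
Qed.

Lemma len_push g x : ~~ last_letter g (inv_letter x) -> len (g * letter x) = (len g).+1.
Proof.
move=> nl; rewrite /len (eq_bigr _ (fun v _ => occ_push v nl)) big_split /= sum_pred1.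
by rewrite addn1.
Qed.

Lemma last_mulV g x : last_letter g x -> ~~ last_letter (g * (letter x)^-1) (inv_letter x).
Proof.
move=> lx; rewrite -letterV /last_letter inv_letterK pile_eltM /act ifT //.
by rewrite -{2}(inv_letterK x); apply: cancels_popV (piled_elt g) _.
Qed.

Lemma occ_pop v g x : last_letter g x ->
  occ v g = (occ v (g * (letter x)^-1)%g + (v == x.1))%N.
Proof. by move=> /last_mulV/(occ_push v); rewrite mulgVK. Qed.

Lemma len_pop g x : last_letter g x -> len g = (len (g * (letter x)^-1)).+1.
Proof. by move=> /last_mulV/len_push; rewrite mulgVK. Qed.

Lemma lastE g x : last_letter g x = (len (g * (letter x)^-1)%g < len g)%N.
Proof.
apply/idP/idP => [/len_pop ->//|]; apply: contraLR => nl.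
have := @len_push g (inv_letter x); rewrite inv_letterK letterV => -> //.
by rewrite -leqNgt.
Qed.

Lemma last_adj g x y : e x.1 y.1 -> last_letter (g * letter y) x = last_letter g x.
Proof. by move=> exy; rewrite /last_letter pile_eltM cancels_act. Qed.

(** The exchange property: if two last letters did not commute, each would have
    covered the sign of the other with a blank. Everything below about suffixes
    comes from this. *)
Lemma last_letters_adj g x y : last_letter g x -> last_letter g y -> x <> y -> e x.1 y.1.
Proof.
move=> lx ly xy; apply: contrapT => /negP nexy.
case: (eqVneq y.1 x.1) => [yx|yx].
  move: lx ly; rewrite /last_letter /cancels /= yx !negbK => /eqP-> /eqP[xy2].
  by apply: xy; case: x y yx xy2 {nexy} => [x b] [y c] /= -> ->.
have := piled_top (piled_elt g) lx yx; rewrite adjC nexy => /(_ isT) P0.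
by move: ly; rewrite /last_letter /cancels /= P0.
Qed.

Lemma occ_word v w : (occ v (of_word w) <= count (fun x => x.1 == v) w)%N.
Proof.
elim/last_ind: w => [|w x IH]; first by rewrite of_word_nil occ1.
rewrite of_word_rcons -cats1 count_cat /= addn0.
have [lx|nlx] := boolP (last_letter (of_word w) (inv_letter x)).
  have := occ_pop v lx; rewrite letterV invgK; lia.
by rewrite occ_push // eq_sym leq_add2r.
Qed.

Lemma reduced_word g : exists w, [/\ of_word w = g, size w = len g &
  forall v, count (fun x => x.1 == v) w = occ v g].
Proof.
elim/reduced_ind: g => [|g x nlx [w [wg sw cw]]].
  by exists [::]; split=> [||v]; rewrite ?of_word_nil ?len1 ?occ1.
exists (rcons w x); split=> [||v]; rewrite ?of_word_rcons ?wg //.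
  by rewrite size_rcons sw len_push.
by rewrite -cats1 count_cat /= addn0 cw occ_push // eq_sym.
Qed.

Lemma occM v g h : (occ v (g * h)%g <= occ v g + occ v h)%N.
Proof.
have [w1 [<- _ <-]] := reduced_word g; have [w2 [<- _ <-]] := reduced_word h.
by rewrite -of_word_cat -count_cat occ_word.
Qed.

Lemma lenM g h : (len (g * h)%g <= len g + len h)%N.
Proof. by rewrite /len -big_split /=; apply: leq_sum => v _; exact: occM. Qed.

Lemma of_word_inv w : of_word (inv_word w) = (of_word w)^-1.
Proof.
by apply: divg1_eq; rewrite invgK -of_word_cat -of_word_nil; apply/of_wordP;
  exact: word_eq_invl.
Qed.

Lemma occV v g : occ v g^-1 = occ v g.
Proof.
suff H h : (occ v h^-1%g <= occ v h)%N.
  by apply/eqP; rewrite eqn_leq H -{1}(invgK g) H.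
have [w [<- _ <-]] := reduced_word h; rewrite -of_word_inv.
by apply: leq_trans (occ_word _ _) _; rewrite count_rev count_map.
Qed.

Lemma lenV g : len g^-1 = len g.
Proof. by apply: eq_bigr => v _; exact: occV. Qed.

Lemma occ_letter v x : occ v (letter x) = (v == x.1).
Proof.
rewrite -(mul1g (letter x)) occ_push ?occ1 //.
by rewrite /last_letter -(piled_uniq piled1).
Qed.

Lemma len_letter x : len (letter x) = 1%N.
Proof. by rewrite /len (eq_bigr _ (fun v _ => occ_letter v x)) sum_pred1. Qed.

Lemma len_eq0 g : len g = 0%N -> g = 1.
Proof.
by have [w [<- <- _]] := reduced_word g => /size0nil ->; exact: of_word_nil.
Qed.

Lemma exists_last g : g <> 1 -> exists x, last_letter g x.
Proof.
elim/reduced_ind: g => // g x nl _ _; exists x; exact: last_mul.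
Qed.

(** * Reduced products *)

(* Stated over raag e, these identities keep every product over one and the
   same instance, so that lia sees equal lengths as equal atoms. *)
Lemma raagA g h k : g * (h * k) = g * h * k. Proof. exact: mulgA. Qed.
Lemma raagVM g h : (g * h)^-1 = (h^-1 : G) * g^-1. Proof. exact: invgM. Qed.
Lemma raagXJ g h n : (g ^ h) ^+ n = (g ^+ n : G) ^ h.
Proof. by rewrite conjXg. Qed.
Lemma raagMJ g h c : (g ^ c) * (h ^ c) = (g * h) ^ c.
Proof. by rewrite conjMg. Qed.
Lemma raagVJ g h : (g ^ h)^-1 = (g^-1 : G) ^ h.
Proof. by rewrite conjVg. Qed.
Lemma raagXSr g n : g ^+ n.+1 = (g ^+ n : G) * g. Proof. exact: expgSr. Qed.
Lemma raagXD g m n : g ^+ (m + n) = (g ^+ m : G) * g ^+ n. Proof. exact: expgnDr. Qed.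

Definition rprod g h := len (g * h) == (len g + len h)%N.

Lemma rprodP g h : reflect (len (g * h) = (len g + len h)%N) (rprod g h).
Proof. exact: eqP. Qed.

Lemma rprod_occ g h v : rprod g h -> occ v (g * h) = (occ v g + occ v h)%N.
Proof.
move=> /rprodP; rewrite /len -big_split /= (bigD1 v) //= [X in _ = X](bigD1 v) //=.
have := occM v g h.
have : (\sum_(i | i != v) occ i (g * h)%g <= \sum_(i | i != v) (occ i g + occ i h))%N.
  by apply: leq_sum => i _; exact: occM.
lia.
Qed.

Lemma rprod1 g : rprod g 1.
Proof. by rewrite /rprod mulg1 len1 addn0. Qed.

Lemma rprod1g g : rprod 1 g.
Proof. by rewrite /rprod mul1g len1. Qed.

Lemma rprodV g h : rprod g h -> rprod h^-1 g^-1.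
Proof. by rewrite /rprod -raagVM !lenV addnC. Qed.

Lemma rprod_letter g x : rprod g (letter x) = ~~ last_letter g (inv_letter x).
Proof.
apply/idP/idP => [/rprodP H|nl]; last by rewrite /rprod len_push // len_letter addn1.
rewrite lastE letterV invgK H len_letter; lia.
Qed.

Lemma rprod_last g x : last_letter g x -> rprod (g * (letter x)^-1) (letter x).
Proof. by move=> lx; rewrite /rprod mulgVK (len_pop lx) len_letter addn1. Qed.

Lemma rprodA_l a b c : rprod (a * b) c -> rprod a b -> rprod a (b * c) /\ rprod b c.
Proof.
move=> /rprodP H1 /rprodP H2; rewrite /rprod.
have := lenM a (b * c); have := lenM b c; rewrite raagA => ? ?; split; apply/eqP; lia.
Qed.

Lemma rprodA_r a b c : rprod a (b * c) -> rprod b c -> rprod (a * b) c /\ rprod a b.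
Proof.
move=> /rprodP H1 /rprodP H2; rewrite /rprod.
have := lenM (a * b) c; have := lenM a b; rewrite -raagA => ? ?; split; apply/eqP; lia.
Qed.

Lemma last_occ g x : last_letter g x -> (0 < occ x.1 g)%N.
Proof. by move=> /(occ_pop x.1) ->; rewrite eqxx addn1. Qed.

Lemma last_rprod_r g h x : rprod g h -> last_letter h x -> last_letter (g * h) x.
Proof.
move=> /rprodP gh; rewrite !lastE gh -raagA; have := lenM g (h * (letter x)^-1); lia.
Qed.

(** A last letter of a reduced product that does not come from the right factor
    has been moved across it, hence is adjacent to all its letters. *)
Lemma last_rprod (p s : G) x : rprod p s -> last_letter (p * s) x ->
  last_letter s x \/ ((forall v, 0 < occ v s -> e x.1 v)%N /\ last_letter p x).
Proof.
elim/reduced_ind: s => [|s y nl IH].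
  by rewrite mulg1 => _ lx; right; split=> // v; rewrite occ1.
have sy : rprod s (letter y) by rewrite rprod_letter.
move=> /rprodA_r/(_ sy)[psy ps]; rewrite raagA => lx.
have ly : last_letter (p * s * letter y) y.
  by apply: last_mul; rewrite -rprod_letter.
have [->|/eqP xy] := eqVneq x y; first by left; exact: last_mul.
have exy := last_letters_adj lx ly xy; rewrite last_adj // in lx.
case: (IH ps lx) => [ls|[os lp]]; first by left; rewrite last_adj.
by right; split=> // v; rewrite occ_push // addn_gt0; case/orP => [/os//|];
  case: eqVneq => // ->.
Qed.

Lemma last_V g x : last_letter g x = (len ((letter x) * g^-1)%g < len g)%N.
Proof. by rewrite lastE -(lenV (g * _)) raagVM invgK. Qed.

(** The supports of g and h span a join. Then g and h commute, and each of them
    lies in the star of every vertex in the support of the other. *)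
Definition orth g h := forall u v, (0 < occ u g)%N -> (0 < occ v h)%N -> e u v.

Lemma orthC g h : orth g h -> orth h g.
Proof. by move=> gh u v ug vh; rewrite adjC; exact: gh. Qed.

Lemma orth1 g : orth g 1.
Proof. by move=> u v _; rewrite occ1. Qed.

Lemma orth_comm g h : orth g h -> g * h = h * g.
Proof.
move=> gh; have letterg y : (forall v, 0 < occ v g -> e v y.1)%N -> commute g (letter y).
  elim/reduced_ind: g {gh} => [|g x nl IH] H; first exact/commute_sym/commute1.
  apply/commute_sym/commuteM.
    by apply/commute_sym/IH => v vg; apply: H; rewrite occ_push // addn_gt0 vg.
  by rewrite /commute letterC // adjC H // occ_push // eqxx addn1.
elim/reduced_ind: h gh => [|h y nl IH] gh; first exact: commute1.
apply: commuteM; first by apply: IH => u v ug vh; apply: gh => //; rewrite occ_push // addn_gt0 vh.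
by apply: letterg => v vg; apply: gh => //; rewrite occ_push // eqxx addn1.
Qed.

Lemma orth_letter x g : (forall v, 0 < occ v g -> e x.1 v)%N -> orth (letter x) g.
Proof. by move=> xg u v; rewrite occ_letter; case: eqVneq => // -> _; exact: xg. Qed.

(** Multiply a by the letters of b^-1 one after the other. The first one that is
    cancelled is the inverse of a last letter of a, and can be moved to the end
    of b. *)
Lemma no_common_last a b :
  (forall x, last_letter a x -> ~~ last_letter b x) -> rprod a b^-1.
Proof.
rewrite -{1}(invgK b); elim/reduced_ind: (b^-1) => [|z y nl IH] ab; first exact: rprod1.
have zy : rprod z (letter y) by rewrite rprod_letter.
have az : rprod a z.
  apply: IH => x /ab; apply: contra; rewrite !last_V !lenV !invgK => xz.
  have /rprodP := zy; rewrite raagA len_letter.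
  have := lenM (letter x * z) (letter y); rewrite len_letter; lia.
suff : rprod (a * z) (letter y) by move=> /rprodA_l/(_ az)[].
rewrite rprod_letter; apply/negP => /(last_rprod az)[lz|[oz la]]; first by rewrite lz in nl.
have /negP := ab _ la; apply; rewrite last_V invgK lenV.
suff -> : letter (inv_letter y) * (z * letter y) = z.
  have /rprodP -> := zy; rewrite len_letter; lia.
have C := orth_comm (orth_letter oz).
by rewrite raagA C -raagA letterV mulVg mulg1.
Qed.

Lemma common_suffix g h : exists c g' h', [/\ g = g' * c, h = h' * c,
  rprod g' c, rprod h' c &
  forall x, last_letter g' x -> ~~ last_letter h' x].
Proof.
have [n] := ubnP (len g); elim: n g h => // n IH g h gn.
have [[x [gx hx]]|no] := pselect (exists x, last_letter g x /\ last_letter h x); last first.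
  exists 1, g, h; rewrite !mulg1 !rprod1; split=> // x gx; apply/negP => hx.
  by apply: no; exists x.
have [|c [g' [h' [gE hE gc hc no]]]] := IH (g * (letter x)^-1) (h * (letter x)^-1).
  by move: gn; rewrite (len_pop gx); lia.
have cx : rprod c (letter x).
  by have := rprod_last gx; rewrite gE => /rprodA_l/(_ gc)[].
exists (c * letter x), g', h'; split=> //.
- by rewrite raagA -gE mulgVK.
- by rewrite raagA -hE mulgVK.
- by have := rprod_last gx; rewrite gE => /rprodA_l/(_ gc)[].
- by have := rprod_last hx; rewrite hE => /rprodA_l/(_ hc)[].
Qed.

(** The source of hyperbolicity. A last letter z of x is a last letter of
    y' * x' that is not one of x', so it moves across x' and is a last letter of
    y'; removing it from x and from y' sets up the induction. *)
Lemma suffix_orth (y x y' x' : G) : y * x = y' * x' -> rprod y x -> rprod y' x' ->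
  (forall z, last_letter x z -> ~~ last_letter x' z) ->
  orth x x' /\ exists q, [/\ y' = q * x, y = q * x', rprod q x & rprod q x'].
Proof.
elim/reduced_ind: x y' => [|x z nl IH] y' E yx yx' no.
  split; first exact/orthC/orth1.
  by exists y'; rewrite mulg1 -E mulg1 in yx' *; split=> //; exact: rprod1.
have xz : rprod x (letter z) by rewrite rprod_letter.
have lz : last_letter (x * letter z) z by exact: last_mul.
have [yxz rx] := rprodA_r yx xz.
have : last_letter (y' * x') z by rewrite -E; apply: last_rprod_r.
move=> /(last_rprod yx')[lx'|[ox' ly']]; first by have := no z lz; rewrite lx'.
pose y'' : G := y' * (letter z)^-1; have y'E : y' = y'' * letter z by rewrite mulgVK.
have zx' : letter z * x' = x' * letter z by exact/orth_comm/orth_letter.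
have E' : y * x = y'' * x'.
  by apply: (mulIg (letter z)); rewrite -[RHS]raagA -zx' raagA -y'E -E raagA.
have ry'' : rprod y'' x'.
  move: yx' yxz yx rx => /rprodP yx' /rprodP yxz /rprodP yx /rprodP rx.
  apply/rprodP; rewrite -E' rx; have := len_pop ly'; rewrite -/y''.
  have /rprodP := xz; rewrite len_letter; rewrite -E in yx'; lia.
have no' (w : V * bool) : last_letter x w -> ~~ last_letter x' w.
  move=> lw; apply/negP => lw'; have := ox' _ (last_occ lw') => ezw.
  by have := no w; rewrite last_adj 1?adjC // lw lw' => /(_ isT).
have [oxx' [q [y''E yE rqx rqx']]] := IH y'' E' rx ry'' no'.
split.
  move=> u v; rewrite occ_push // addn_gt0 => /orP[|]; first exact: oxx'.
  by case: eqVneq => // -> _; exact: ox'.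
exists q; split=> //; first by rewrite y'E y''E raagA.
apply/rprodP; rewrite raagA -y''E -y'E (len_pop ly') -/y'' y''E.
by rewrite (eqP rqx) (eqP xz) len_letter addn1 addnS.
Qed.

(** Riesz decomposition: two reduced factorizations have a common refinement.
    The pieces s' and y2 occur in opposite orders in the two, so they have to be
    orthogonal. *)
Lemma rprod_refine (y x s t : G) : y * x = s * t -> rprod y x -> rprod s t ->
  exists y1 y2 s' t' : G, [/\ [/\ y = y1 * y2, s = y1 * s', t = y2 * t' & x = s' * t'],
    [/\ rprod y1 y2, rprod y1 s', rprod y2 t' & rprod s' t'] & orth s' y2].
Proof.
move=> E ryx rst; have [t' [s' [y2 [xE tE rs't' ry2t' no]]]] := common_suffix x t.
rewrite xE in ryx; rewrite tE in rst.
have E' : y * s' = s * y2 by apply: (mulIg t'); rewrite -!raagA -xE -tE.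
have [_ rys'] := rprodA_r ryx rs't'; have [_ rsy2] := rprodA_r rst ry2t'.
have [os'y2 [q [-> -> rqs' rqy2]]] := suffix_orth E' rys' rsy2 no.
by exists q, y2, s', t'.
Qed.

(** * Stars and commuting conjugates of generators *)

(** That g lies in the subgroup generated by the star of v, in other words that
    g commutes with v. *)
Definition star v g := forall u, (0 < occ u g)%N -> (u == v) || e v u.

Lemma star1 v : star v 1.
Proof. by move=> u; rewrite occ1. Qed.

Lemma starM v g h : star v g -> star v h -> star v (g * h).
Proof.
move=> sg sh u; have := occM u g h => ugh up.
have : (0 < occ u g)%N \/ (0 < occ u h)%N by lia.
by case=> [/sg|/sh].
Qed.

Lemma starV v g : star v g -> star v g^-1.
Proof. by move=> sg u; rewrite occV; exact: sg. Qed.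

Lemma star_l v g h : rprod g h -> star v (g * h) -> star v g.
Proof. by move=> gh s u ug; apply: s; rewrite (rprod_occ _ gh) addn_gt0 ug. Qed.

Lemma star_r v g h : rprod g h -> star v (g * h) -> star v h.
Proof. by move=> gh s u uh; apply: s; rewrite (rprod_occ _ gh) addn_gt0 uh orbT. Qed.

Lemma star_letter v x : x.1 = v -> star v (letter x).
Proof. by move=> xv u; rewrite occ_letter xv; case: eqVneq. Qed.

Lemma occ_gt0 g : g <> 1 -> exists v, (0 < occ v g)%N.
Proof. by move=> /exists_last[x /last_occ]; exists x.1. Qed.

Lemma orth_star_r g h : orth g h -> g <> 1 -> exists2 v, (0 < occ v g)%N & star v h.
Proof.
move=> gh /occ_gt0[v vg]; exists v => // u uh.
by rewrite (gh v u) // orbT.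
Qed.

Definition gen v : G := raag_gen e v.

Lemma genE v : gen v = letter (v, true). Proof. by []. Qed.

Lemma star_gen_comm v s : star v s -> gen v * s = s * gen v.
Proof.
rewrite genE; elim/reduced_ind: s => [|s x nl IH] sv; first by rewrite mul1g mulg1.
have sx : rprod s (letter x) by rewrite rprod_letter.
have := star_r sx sv; move/(_ x.1); rewrite occ_letter eqxx => /(_ isT) xv.
rewrite mulgA IH -?mulgA; last exact: star_l sx sv.
congr (_ * _); case/orP: xv => [/eqP xv|evx]; last exact: letterC.
case: x xv {nl sv sx} => u [] /= ->; first by [].
by rewrite -[(v, false)]/(inv_letter (v, true)) letterV mulgV mulVg.
Qed.

Lemma conj_star v s : star v s -> gen v ^ s = gen v.
Proof. by move=> sv; rewrite conjgE star_gen_comm // mulKg. Qed.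

Lemma letter_last x : last_letter (letter x) x.
Proof.
have := @last_mul 1 x; rewrite mul1g; apply.
by apply/negP => /last_occ; rewrite occ1.
Qed.

Lemma last_of_letter x y : last_letter (letter y) x -> x = y.
Proof.
move=> lx; apply: contrapT => xy.
have := last_occ lx; rewrite occ_letter; case: eqVneq => // xy1 _.
by have := last_letters_adj lx (letter_last y) xy; rewrite xy1 adjxx.
Qed.

Lemma last_gen v x : last_letter (gen v) x -> x = (v, true).
Proof. exact: last_of_letter. Qed.

Lemma len_gen v : len (gen v) = 1%N. Proof. exact: len_letter. Qed.
Lemma occ_gen u v : occ u (gen v) = (u == v). Proof. exact: occ_letter. Qed.

Lemma gen_last v : last_letter (gen v) (v, true).
Proof. exact: letter_last. Qed.

Lemma gen_inj u v : gen u = gen v -> u = v.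
Proof. by move=> E; have := gen_last u; rewrite E => /last_gen[]. Qed.

Lemma gen_comm u v : commute (gen u) (gen v) -> (u == v) || e u v.
Proof.
case: (eqVneq u v) => //= /eqP uv C.
have lu : last_letter (gen v * gen u) (u, true).
  by apply: last_rprod_r (gen_last u); rewrite rprod_letter;
    apply/negP => /last_gen[].
have lv : last_letter (gen v * gen u) (v, true).
  by rewrite -C; apply: last_rprod_r (gen_last v); rewrite rprod_letter;
    apply/negP => /last_gen[].
by apply: (last_letters_adj lu lv) => -[].
Qed.

Lemma commuteJ g h s : commute (g ^ s) (h ^ s) -> commute g h.
Proof. by move=> C; apply: (@conjg_inj _ s); rewrite /= !conjMg. Qed.

Lemma star_double_coset (v w : V) c : exists a c' s,
  [/\ c = a * c' * s, star w a, star v s,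
   forall x, last_letter c' x -> ~~ ((x.1 == v) || e v x.1) &
   forall x, last_letter c'^-1 x -> ~~ ((x.1 == w) || e w x.1)].
Proof.
have [n] := ubnP (len c); elim: n c => // n IH c cn.
have [[x [lx sx]]|nr] := pselect (exists x, last_letter c x /\ (x.1 == v) || e v x.1).
  have [|a [c' [s [cE sa ss nl nf]]]] := IH (c * (letter x)^-1).
    by have := len_pop lx; lia.
  exists a, c', (s * letter x); split=> //; first by rewrite mulgA -cE mulgVK.
  by apply: starM => // u; rewrite occ_letter; case: eqVneq => // ->.
have [[x [lx sx]]|nf] := pselect (exists x, last_letter c^-1 x /\ (x.1 == w) || e w x.1).
  have [|a [c' [s [cE sa ss nl nf]]]] := IH (letter x * c).
    by have := len_pop lx; rewrite lenV -raagVM lenV; lia.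
  exists ((letter x)^-1 * a), c', s; split=> //.
    by rewrite -2!mulgA (mulgA a) -cE mulKg.
  apply: starM => //; apply: starV => u.
  by rewrite occ_letter; case: eqVneq => // ->.
exists 1, c, 1; rewrite mul1g mulg1; split=> //; try exact: star1.
- by move=> x lx; apply/negP => sx; apply: nr; exists x.
- by move=> x lx; apply/negP => sx; apply: nf; exists x.
Qed.

(** Let c' be the shortest element of the double coset of c. If c' is not 1 then
    the product c'^-1 * w * c' is reduced and its last letters are those of c',
    which are not in the star of v. So v is a last letter of (w ^ c') * v but not
    of v * (w ^ c'), and these differ. *)
Lemma conj_comm_star (v w : V) c : commute (gen w ^ c) (gen v) ->
  exists a s, [/\ c = a * s, star w a & star v s].
Proof.
have [a [c' [s [-> sa ss nl nf]]]] := star_double_coset v w c.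
have [->|/eqP c'1] := eqVneq c' 1; first by exists a, s; rewrite mulg1.
rewrite 2!conjgM (conj_star sa) -(conj_star ss) => C; exfalso.
have {}C : commute (gen w ^ c') (gen v).
  exact: commuteJ C.
have rw : rprod (gen w) c'.
  rewrite -(invgK c'); apply: no_common_last => x /last_gen ->.
  by apply/negP => /nf /=; rewrite eqxx.
have rq : rprod c'^-1 (gen w * c').
  rewrite -[gen w * c']invgK; apply: no_common_last => x lx; apply/negP.
  rewrite raagVM => lx'; have rV : rprod c'^-1 (gen w)^-1 := rprodV rw.
  have := nf _ lx; case: (last_rprod rV lx') => [/last_occ|[ow _]].
    by rewrite occV occ_gen; case: eqVneq => // ->; rewrite eqxx.
  by rewrite adjC ow ?orbT // occV occ_gen eqxx.
have occq u : (0 < occ u c')%N -> (0 < occ u (gen w ^ c')%g)%N.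
  by rewrite conjgE (rprod_occ _ rq) (rprod_occ _ rw) !addn_gt0 => ->; rewrite !orbT.
have lq x : last_letter (gen w ^ c') x -> ~~ ((x.1 == v) || e v x.1).
  move=> /(last_rprod rq)[/(last_rprod rw)[/nl//|[xc' /last_gen xw]]|[oc' lx]].
    have [|y ly] := @exists_last c'^-1; first by rewrite -invg1 => /invg_inj.
    have := nf _ ly; have := xc' y.1; rewrite xw -(occV _ c') last_occ // => ->//.
    by rewrite orbT.
  have := oc' x.1; rewrite adjxx (rprod_occ _ rw) -(occV _ c').
  by have := last_occ lx; case: occ => // n _; rewrite addnS => /(_ isT).
have rqv : rprod (gen w ^ c') (gen v).
  by rewrite rprod_letter; apply/negP => /lq /=; rewrite eqxx.
have rvq : rprod (gen v) (gen w ^ c') by rewrite /rprod -C (eqP rqv) addnC.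
have : last_letter (gen v * gen w ^ c') (v, true).
  by rewrite -C; exact: last_rprod_r (gen_last v).
move=> /(last_rprod rvq)[/lq /=|[oq _]]; first by rewrite eqxx.
have [y ly] := exists_last c'1; have := nl _ ly.
by rewrite (oq y.1) ?orbT // occq // last_occ.
Qed.

(** Two commuting vertices of the extension graph belong to one translate of the
    defining graph, the translate by k. *)
Lemma commuting_vertices u v g h : commute (gen u ^ g) (gen v ^ h) ->
  exists s k, [/\ k = s * g, star u s & gen v ^ h = gen v ^ k].
Proof.
move=> C; have {}C : commute (gen v ^ (h * g^-1)) (gen u).
  by apply: (@commuteJ _ _ g); rewrite -conjgM mulgVK; exact/commute_sym.
have [a [s [E sa ss]]] := conj_comm_star C.
exists s, (s * g); split=> //.
by rewrite -(mulgVK g h) E -mulgA conjgM (conj_star sa).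
Qed.

(** * Walks in the extension graph as products of star elements *)

Implicit Types (p q r : V) (i j m n : nat).

(** For a walk p = u_0, ..., u_n = q in the defining graph, products
    g = s_n * ... * s_1 * s_0 with s_i in the star of u_i. They are the walks of
    length n from p to q ^ g in the extension graph (star_path_ext_walk and
    ext_walk_star_path): its vertices are the u_i ^ (s_(i-1) * ... * s_0). *)
Inductive star_path (p : V) : nat -> V -> G -> Prop :=
| star_path0 s : star p s -> star_path p 0 p s
| star_pathS n q (q' : V) s g : star_path p n q g -> e q q' -> star q' s ->
    star_path p n.+1 q' (s * g).

Lemma star_path_mul p n q g s : star_path p n q g -> star q s ->
  star_path p n q (s * g).
Proof.
case=> [t pt qs|m q1 q' t h H qq' st ss]; first by apply: star_path0; exact: starM.
by rewrite mulgA; apply: star_pathS H qq' _; exact: starM.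
Qed.

Lemma star_path_cat p n q m r g h : star_path p n q g -> star_path q m r h ->
  star_path p (n + m) r (h * g).
Proof.
move=> pq; elim=> [s ss|{}m r1 r' s {}h _ IH rr' ss].
  by rewrite addn0; exact: star_path_mul.
by rewrite addnS -mulgA; exact: star_pathS IH rr' ss.
Qed.

Lemma star_path_walk p l : path e p l -> star_path p (size l) (last p l) 1.
Proof.
elim/last_ind: l => [|l q IH]; first by move=> _; apply/star_path0/star1.
rewrite rcons_path last_rcons size_rcons => /andP[/IH pl lq].
by rewrite -(mulg1 1); apply: star_pathS pl lq _; exact: star1.
Qed.

Inductive rstar_path (p : V) : nat -> V -> G -> Prop :=
| rstar_path0 s : star p s -> rstar_path p 0 p s
| rstar_pathS n q (q' : V) s g : rstar_path p n q g -> e q q' -> star q' s -> rprod s g ->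
    rstar_path p n.+1 q' (s * g).

Lemma rstar_pathW p n q g : rstar_path p n q g -> star_path p n q g.
Proof.
elim=> [s|m q1 q' s h _ IH qq' ss _]; first exact: star_path0.
exact: star_pathS IH qq' ss.
Qed.

Lemma rstar_path_suffix p n q (y x : G) : rstar_path p n q (y * x) -> rprod y x ->
  rstar_path p n q x.
Proof.
move: {-2}(y * x) (erefl (y * x)) => g gE H.
elim: H y x gE => [s ps|m q1 q' s h H IH qq' ss sh] y x E yx.
  by apply: rstar_path0; rewrite E in ps; exact: star_r yx ps.
have [y1 [y2 [s' [t' [[yE sE hE xE] [_ ry1s' ry2t' rs't'] _]]]]] :=
  rprod_refine (esym E) yx sh.
rewrite xE; apply: rstar_pathS (IH y2 t' hE ry2t') qq' _ rs't'.
by rewrite sE in ss; exact: star_r ry1s' ss.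
Qed.

(** Letters that cancel between two factors can be deleted from both, because a
    star subgroup contains the subwords of its reduced words. *)
Lemma star_path_reduce p n q g : star_path p n q g -> rstar_path p n q g.
Proof.
elim=> [s|m q1 q' s h _ IH qq' ss]; first exact: rstar_path0.
have [c [s1 [k [sE kE s1c kc no]]]] := common_suffix s h^-1.
have hE : h = c^-1 * k^-1 by rewrite -raagVM -kE invgK.
have -> : s * h = s1 * k^-1 by rewrite sE hE mulgA mulgK.
apply: rstar_pathS qq' _ (no_common_last no).
  by move: IH; rewrite hE => /rstar_path_suffix; apply; exact: rprodV.
by rewrite sE in ss; exact: star_l s1c ss.
Qed.

(** Star paths are additive along reduced products, up to a constant. Refine the
    factorization y * x against the last factor s = y1 * s' and the product h of
    the others. If s' = 1 then x is a part of h, and induction applies to h.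
    Otherwise the part y2 of y that lies in h is orthogonal to s', so it lies in
    one star, and y = y1 * y2 takes one step. *)
Lemma rstar_path_split p n q (y x : G) : rstar_path p n q (y * x) -> rprod y x ->
  exists i j u v, [/\ star_path p i u x, star_path v j q y & i + j <= n.+1]%N.
Proof.
move: {-2}(y * x) (erefl (y * x)) => g gE H.
elim: H y x gE => [s ps|m q1 q' s h H IH qq' ss sh] y x E yx.
  rewrite E in ps; exists 0%N, 0%N, p, p; split=> //; apply: star_path0.
    exact: star_r yx ps.
  exact: star_l yx ps.
have [y1 [y2 [s' [t' [[yE sE hE xE] [_ ry1s' ry2t' rs't'] o]]]]] :=
  rprod_refine (esym E) yx sh.
have sy1 : star q' y1 by rewrite sE in ss; exact: star_l ry1s' ss.
have [s'1|/eqP s'1] := eqVneq s' 1.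
  have [i [j [a [b [pi bj ij]]]]] := IH y2 t' hE ry2t'.
  exists i, j.+1, a, b; rewrite xE s'1 mul1g yE; split=> //; last by rewrite addnS.
  exact: star_pathS bj qq' sy1.
have [r rs' ry2] := orth_star_r o s'1.
have qr : (r == q') || e q' r.
  by apply: ss; rewrite sE (rprod_occ _ ry1s') addn_gt0 rs' orbT.
have px : star_path p m.+1 q' x.
  by apply: rstar_pathW; apply: (rstar_path_suffix _ yx); rewrite -E; exact: rstar_pathS H qq' ss sh.
rewrite yE; case/orP: qr => [/eqP rq|qr].
  exists m.+1, 0%N, q', q'; split=> //; last by rewrite addn0.
  by apply: star_path0; apply: starM => //; rewrite -rq.
exists m.+1, 1%N, q', r; split=> //; last by rewrite addn1.
by apply: star_pathS sy1; [exact: star_path0 | rewrite adjC].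
Qed.

Lemma gen_vertex_subproof v : is_vertex_conj (raag_gen e v).
Proof. by apply/asboolP; exists v, 1; rewrite conjg1. Qed.

Definition gen_vertex v : ext_vertex e := Sub (gen v) (gen_vertex_subproof v).
Definition conj_vertex v g : ext_vertex e := ext_conj g (gen_vertex v).

Lemma val_conj_vertex v g : val (conj_vertex v g) = gen v ^ g. Proof. by []. Qed.

Lemma conj_vertex1 v : conj_vertex v 1 = gen_vertex v.
Proof. by apply: val_inj; rewrite val_conj_vertex conjg1. Qed.

Lemma conj_vertexP (X : ext_vertex e) : exists v g, X = conj_vertex v g.
Proof.
case: (X) => a aP; have /asboolP[v [g aE]] := aP.
by exists v, g; apply: val_inj.
Qed.

Lemma ext_conjM g h (X : ext_vertex e) : ext_conj (g * h) X = ext_conj h (ext_conj g X).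
Proof. by apply: val_inj; rewrite /= conjgM. Qed.

Lemma ext_conj1 (X : ext_vertex e) : ext_conj 1 X = X.
Proof. by apply: val_inj; rewrite /= conjg1. Qed.

Lemma ext_adj_sym : symmetric (@ext_adj V e).
Proof. by move=> X Y; rewrite /ext_adj eq_sym [in RHS]eq_sym [(val Y * _ == _)]eq_sym eq_sym. Qed.

Lemma star_path_ext_walk p n q g : star_path p n q g ->
  has_walk (@ext_adj V e) (gen_vertex p) (conj_vertex q g) n.
Proof.
elim=> [s ps|m q1 q' s h _ [l [pl ll sl]] qq' ss].
  by exists [::]; split=> //; apply: val_inj; rewrite val_conj_vertex conj_star.
exists (rcons l (conj_vertex q' (s * h))); split; rewrite ?last_rcons ?size_rcons ?sl //.
rewrite rcons_path pl ll /= /ext_adj.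
have -> : conj_vertex q' (s * h) = conj_vertex q' h.
  by apply: val_inj; rewrite !val_conj_vertex conjgM (conj_star ss).
apply/andP; split.
  apply: contraTneq qq' => /(congr1 val); rewrite !val_conj_vertex => /conjg_inj/gen_inj ->.
  by rewrite adjxx.
rewrite !val_conj_vertex -!conjMg star_gen_comm //.
by move=> u; rewrite occ_gen; case: eqVneq => // ->; rewrite qq' orbT.
Qed.

Lemma ext_walk_star_path p l : path (@ext_adj V e) (gen_vertex p) l ->
  exists q g, last (gen_vertex p) l = conj_vertex q g /\ star_path p (size l) q g.
Proof.
elim/last_ind: l => [_|l X IH].
  by exists p, 1; rewrite conj_vertex1; split=> //; apply/star_path0/star1.
rewrite rcons_path last_rcons size_rcons => /andP[/IH[q [g [-> pg]]] /andP[qX /eqP C]].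
have [v [h XE]] := conj_vertexP X; rewrite XE !val_conj_vertex in C qX *.
have [s [k [kE qs hk]]] := commuting_vertices C.
have vk : conj_vertex v h = conj_vertex v k by apply: val_inj.
have qk : gen q ^ g = gen q ^ k by rewrite kE conjgM (conj_star qs).
exists v, k; split=> //; rewrite -[k]mul1g; apply: (@star_pathS _ _ q).
- by rewrite kE; exact: star_path_mul.
- rewrite hk qk in C; have /gen_comm/orP[/eqP qv|//] := commuteJ C.
  by case/eqP: qX; apply: val_inj; rewrite !val_conj_vertex qk hk qv.
- exact: star1.
Qed.

(** * Hyperbolicity of the extension graph *)

Hypothesis e_conn : connected_graph e.

Lemma star_path_base p q : exists2 n, (n <= #|V|)%N & star_path p n q 1.
Proof.
have /connectP[l pl ->] := e_conn.2 p q; have [l' pl' ul' _] := shortenP pl.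
exists (size l'); last exact: star_path_walk.
by apply: ltnW; have /= <- := card_uniqP ul'; exact: max_card.
Qed.

Lemma star_path_exists p q g : exists n, star_path p n q g.
Proof.
elim/of_word_ind: g p q => [|g x IH] p q.
  by have [n _] := star_path_base p q; exists n.
have [n _ pn] := star_path_base p x.1; have [m qm] := IH x.1 q.
exists (n + m)%N; apply: star_path_cat qm.
by rewrite -[letter x]mulg1; apply: star_path_mul => //; exact: star_letter.
Qed.

Implicit Types X Y Z : ext_vertex e.

Lemma walk_sym X Y n : has_walk (@ext_adj V e) X Y n -> has_walk (@ext_adj V e) Y X n.
Proof.
move=> [l [pl <- <-]]; exists (rev (belast X l)); split.
- by rewrite rev_path (eq_path (e' := @ext_adj V e)) // => ? ?; exact: ext_adj_sym.
- by case: l {pl} => //= Z l; rewrite rev_cons last_rcons.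
- by rewrite size_rev size_belast.
Qed.

Lemma walk_cat X Y Z m n : has_walk (@ext_adj V e) X Y m ->
  has_walk (@ext_adj V e) Y Z n -> has_walk (@ext_adj V e) X Z (m + n).
Proof.
move=> [l [pl <- <-]] [k [pk <- <-]]; exists (l ++ k).
by rewrite cat_path pl last_cat size_cat.
Qed.

Lemma walk_exists X Y : exists n, has_walk (@ext_adj V e) X Y n.
Proof.
have [u [g ->]] := conj_vertexP X; have [v [h ->]] := conj_vertexP Y.
have [n /star_path_ext_walk/(has_walkJ g)] := star_path_exists u v (h * g^-1).
by rewrite -ext_conjM mulgVK; exists n.
Qed.

Lemma ext_dist_walk X Y : has_walk (@ext_adj V e) X Y (ext_dist X Y).
Proof.
rewrite /ext_dist /graph_dist; case: pselect => [h|[]].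
  by case: ex_minnP => n /asboolP.
by have [n w] := walk_exists X Y; exists n; apply/asboolP.
Qed.

Lemma ext_dist_le X Y n : has_walk (@ext_adj V e) X Y n -> (ext_dist X Y <= n)%N.
Proof.
move=> w; rewrite /ext_dist /graph_dist; case: pselect => // h.
by case: ex_minnP => m _; apply; apply/asboolP.
Qed.

Lemma ext_distC X Y : ext_dist X Y = ext_dist Y X.
Proof.
by apply/eqP; rewrite eqn_leq !ext_dist_le //; exact/walk_sym/ext_dist_walk.
Qed.

Lemma ext_dist_triangle Y X Z : (ext_dist X Z <= ext_dist X Y + ext_dist Y Z)%N.
Proof. apply: ext_dist_le; apply: walk_cat; exact: ext_dist_walk. Qed.

Lemma ext_distxx X : ext_dist X X = 0%N.
Proof. by apply/eqP; rewrite -leqn0; apply: ext_dist_le; exists [::]. Qed.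

Variable v0 : V.
(** A length function on the group: v0 ^ g and v0 ^ h are at distance
    slen (h * g^-1), so that common suffixes play the part of common initial
    segments (slen_conj_vertex). *)
Definition slen g := ext_dist (gen_vertex v0) (conj_vertex v0 g).

Lemma star_path_ext_dist p n q g : star_path p n q g -> (ext_dist (gen_vertex p) (conj_vertex q g) <= n)%N.
Proof. by move=> /star_path_ext_walk/ext_dist_le. Qed.

(** A geodesic to v0 ^ g gives a star path for some h with q ^ h = v0 ^ g. Then
    q = v0, and g and h differ by an element of the star of v0, which the last
    factor absorbs. *)
Lemma slen_star_path g : star_path v0 (slen g) v0 g.
Proof.
rewrite /slen; have [l [pl ll <-]] := ext_dist_walk (gen_vertex v0) (conj_vertex v0 g).
have [q [h [E H]]] := ext_walk_star_path pl; rewrite ll in E.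
have C : commute (gen q ^ h) (gen v0 ^ g).
  by rewrite -!val_conj_vertex -E.
have [s [k [kE qs gk]]] := commuting_vertices C.
have qv : q = v0.
  have : gen q ^ k = gen v0 ^ k.
    by rewrite -gk -(val_conj_vertex v0 g) E val_conj_vertex kE conjgM (conj_star qs).
  by move=> /conjg_inj/gen_inj.
rewrite qv in H C.
have [a [t [gkE sa st]]] : exists a t, [/\ g * h^-1 = a * t, star v0 a & star v0 t].
  apply: conj_comm_star; apply: (@commuteJ _ _ h); rewrite -conjgM mulgVK.
  exact/commute_sym.
rewrite -(mulgVK h g) gkE -mulgA.
by do 2![apply: star_path_mul => //].
Qed.

Lemma slen_le n p q g : star_path p n q g -> (slen g <= n + 2 * #|V|)%N.
Proof.
move=> H; have [m mV pm] := star_path_base v0 p; have [k kV qk] := star_path_base q v0.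
have := star_path_ext_dist (star_path_cat (star_path_cat pm H) qk).
rewrite mulg1 mul1g -/(slen g); lia.
Qed.

Lemma slen_conj_vertex g h : ext_dist (conj_vertex v0 g) (conj_vertex v0 h) = slen (h * g^-1).
Proof.
by rewrite /slen -(ext_distJ g^-1) /conj_vertex -!ext_conjM mulgV ext_conj1.
Qed.

Lemma slen1 : slen 1 = 0%N.
Proof. by rewrite /slen conj_vertex1 ext_distxx. Qed.

Lemma slenV g : slen g^-1 = slen g.
Proof. by rewrite /slen -(ext_distJ g) /conj_vertex -!ext_conjM mulVg ext_conj1 ext_distC. Qed.

Lemma slenM g h : (slen (g * h)%g <= slen g + slen h)%N.
Proof.
rewrite {1}/slen; apply: leq_trans (ext_dist_triangle (conj_vertex v0 h) _ _) _.
by rewrite slen_conj_vertex mulgK addnC.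
Qed.

Let d := (2 * #|V|)%N.

Lemma slen_star v g : star v g -> (slen g <= d)%N.
Proof. by move=> vg; apply: (@slen_le 0 v v); exact: star_path0. Qed.

Lemma slen_rprod (y x : G) : rprod y x -> (slen y + slen x <= slen (y * x)%g + d.+1)%N.
Proof.
move=> yx; have H := star_path_reduce (slen_star_path (y * x)).
have [i [j [u [v [pi qj ij]]]]] := rstar_path_split H yx.
have [m mV um] := star_path_base u v0; have [k kV kv] := star_path_base v0 v.
have := star_path_ext_dist (star_path_cat pi um).
have := star_path_ext_dist (star_path_cat kv qj).
rewrite mulg1 mul1g -/(slen x) -/(slen y) /d; lia.
Qed.

Definition suffix c g := rprod (g * c^-1) c.

Lemma suffixP c g : reflect (exists2 y, g = y * c & rprod y c) (suffix c g).
Proof.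
apply: (iffP idP) => [H|[y -> yc]]; last by rewrite /suffix mulgK.
by exists (g * c^-1); rewrite ?mulgVK.
Qed.

Lemma suffix_mul g c : rprod g c -> suffix c (g * c).
Proof. by move=> gc; apply/suffixP; exists g. Qed.

Lemma suffix_trans a b c : suffix a b -> suffix b c -> suffix a c.
Proof.
move=> /suffixP[y -> ya] /suffixP[z -> zya].
have [zy _] := rprodA_r zya ya; rewrite mulgA; exact: suffix_mul.
Qed.

(** Let c be the longest common suffix of a and b. What remains of a and of b is
    orthogonal by suffix_orth, so either one of the two is trivial or each lies
    in a star and is short. *)
Lemma suffix_meet a b h : suffix a h -> suffix b h ->
  exists c, [/\ suffix c a, suffix c b &
    (slen a <= slen c + d)%N /\ (slen b <= slen c + d)%N \/ c = a \/ c = b].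
Proof.
move=> /suffixP[y hE ya] /suffixP[y' hE' yb].
have [c [a' [b' [aE bE ac bc no]]]] := common_suffix a b.
exists c; split; [by rewrite aE; exact: suffix_mul|by rewrite bE; exact: suffix_mul|].
have [a1|/eqP a1] := eqVneq a' 1; first by right; left; rewrite aE a1 mul1g.
have [b1|/eqP b1] := eqVneq b' 1; first by right; right; rewrite bE b1 mul1g.
left; rewrite aE bE in hE hE' ya yb *.
have [_ ya'] := rprodA_r ya ac; have [_ yb'] := rprodA_r yb bc.
have E : y * a' = y' * b' by apply: (mulIg c); rewrite -!mulgA -hE.
have [oab _] := suffix_orth E ya' yb' no.
have [u _ /slen_star sb'] := orth_star_r oab a1.
have [v _ /slen_star sa'] := orth_star_r (orthC oab) b1.
have := slenM a' c; have := slenM b' c; lia.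
Qed.

(** The Gromov product of v0 ^ g and v0 ^ h at v0 is the length of their longest
    common suffix up to a constant: after the removal of that suffix, the product
    of h and g^-1 is reduced and slen_rprod applies. *)
Lemma gromov_product_le g h : exists c, [/\ suffix c g, suffix c h &
  (slen g + slen h <= slen (h * g^-1)%g + 2 * slen c + d.+1)%N].
Proof.
have [c [g' [h' [gE hE gc hc no]]]] := common_suffix g h.
exists c; split; [by rewrite gE; exact: suffix_mul|by rewrite hE; exact: suffix_mul|].
have r : rprod h' g'^-1 by have := rprodV (no_common_last no); rewrite invgK.
have -> : h * g^-1 = h' * g'^-1 by rewrite hE gE raagVM mulgA mulgK.
have := slen_rprod r; have := slenM g' c; have := slenM h' c.
rewrite slenV gE hE; lia.
Qed.

Lemma gromov_product_ge c g h : suffix c g -> suffix c h ->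
  (slen (h * g^-1)%g + 2 * slen c <= slen g + slen h + 2 * d.+1)%N.
Proof.
move=> /suffixP[g' -> gc] /suffixP[h' -> hc].
have -> : h' * c * (g' * c)^-1 = h' * g'^-1 by rewrite raagVM mulgA mulgK.
have := slen_rprod gc; have := slen_rprod hc; have := slenM h' g'^-1.
rewrite slenV; lia.
Qed.

Let D := (10 * d.+1)%N.

(** The longest common suffix of g and h, and that of h and k, are suffixes of h,
    hence nearly comparable. The smaller of the two is a common suffix of g and
    k, which is the hyperbolic inequality for Gromov products at v0. *)
Lemma slen_four_points g h (k : G) :
  (slen h + slen (k * g^-1)%g <= slen k + slen (h * g^-1)%g + D)%N \/
  (slen h + slen (k * g^-1)%g <= slen g + slen (k * h^-1)%g + D)%N.
Proof.
have [a [ag ah aE]] := gromov_product_le g h.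
have [b [bh bk bE]] := gromov_product_le h k.
have [c [ca cb]] := suffix_meet ah bh.
have := gromov_product_ge (suffix_trans ca ag) (suffix_trans cb bk).
rewrite /D; case: (leqP (slen a) (slen b)) => ab ge [[]|[E|E]]; rewrite ?E in ge *; lia.
Qed.

Lemma near_conj_vertex X : exists g, (ext_dist X (conj_vertex v0 g) <= #|V|)%N.
Proof.
have [u [g ->]] := conj_vertexP X; exists g; have [n nV /star_path_ext_dist un] := star_path_base u v0.
apply: leq_trans nV; move: un; rewrite -(ext_distJ g) -ext_conjM mul1g.
by [].
Qed.

Definition hyp_const := (D + 4 * d)%N.

Lemma ext_four_points W X Y Z :
  (ext_dist W Y + ext_dist X Z <= ext_dist W Z + ext_dist X Y + hyp_const)%N \/
  (ext_dist W Y + ext_dist X Z <= ext_dist W X + ext_dist Y Z + hyp_const)%N.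
Proof.
have [f Wf] := near_conj_vertex W; have [g Xg] := near_conj_vertex X.
have [h Yh] := near_conj_vertex Y; have [k Zk] := near_conj_vertex Z.
have close A B a b : (ext_dist A (conj_vertex v0 a) <= #|V|)%N ->
    (ext_dist B (conj_vertex v0 b) <= #|V|)%N ->
    (ext_dist A B <= slen (b * a^-1)%g + d)%N /\ (slen (b * a^-1)%g <= ext_dist A B + d)%N.
  move=> Aa Bb; rewrite -slen_conj_vertex.
  have := ext_dist_triangle (conj_vertex v0 a) A B.
  have := ext_dist_triangle (conj_vertex v0 b) (conj_vertex v0 a) B.
  have := ext_dist_triangle A (conj_vertex v0 a) (conj_vertex v0 b).
  have := ext_dist_triangle B A (conj_vertex v0 b).
  rewrite (ext_distC (conj_vertex v0 a) A) (ext_distC (conj_vertex v0 b) B) /d; lia.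
have E a b : b * f^-1 * (a * f^-1)^-1 = b * a^-1 by rewrite raagVM invgK -mulgA mulKg.
have := slen_four_points (g * f^-1) (h * f^-1) (k * f^-1); rewrite !E /hyp_const.
have := close _ _ _ _ Wf Xg; have := close _ _ _ _ Wf Yh; have := close _ _ _ _ Wf Zk.
have := close _ _ _ _ Xg Yh; have := close _ _ _ _ Xg Zk; have := close _ _ _ _ Yh Zk.
lia.
Qed.

(** * Cyclically reduced elements *)

Lemma not_rprod g h : ~~ rprod g h -> exists2 x, last_letter g x & last_letter h^-1 x.
Proof.
move=> n; apply: contrapT => no; case/negP: n; rewrite -(invgK h).
by apply: no_common_last => x gx; apply/negP => hx; apply: no; exists x.
Qed.

Lemma rprod_not_last g h x : rprod g h -> last_letter g x -> ~~ last_letter h^-1 x.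
Proof.
move=> /rprodP gh lg; apply/negP => lh.
have := lenM (g * (letter x)^-1) (letter x * h); rewrite mulgA mulgVK gh.
have := len_pop lg; have := len_pop lh; rewrite lenV -raagVM lenV; lia.
Qed.

(** A cancellation between non-adjacent copies of g would move a letter of g
    across a copy of g, which contains that letter. *)
Lemma rprod_pow g n : rprod g g -> rprod (g ^+ n) g.
Proof.
move=> gg; elim: n => [|n IH]; first exact: rprod1g.
rewrite raagXSr; apply: contrapT => /negP/not_rprod[x lx lVx].
case: (last_rprod IH lx) => [lgx|[og _]].
  by have := rprod_not_last gg lgx; rewrite lVx.
by have := og x.1; rewrite adjxx -occV last_occ // => /(_ isT).
Qed.

Lemma len_pow g n : rprod g g -> len (g ^+ n) = (n * len g)%N.
Proof.
move=> gg; elim: n => [|n IH]; first exact: len1.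
by rewrite raagXSr (eqP (rprod_pow n gg)) IH mulSn addnC.
Qed.

Lemma rprod_pow2 g m n : rprod g g -> rprod (g ^+ m) (g ^+ n).
Proof. by move=> gg; rewrite /rprod -raagXD !len_pow // mulnDl. Qed.

Lemma occ_pow g n v : (0 < occ v (g ^+ n))%N -> (0 < occ v g)%N.
Proof.
elim: n => [|n IH]; first by rewrite expg0 occ1.
rewrite raagXSr; have := occM v (g ^+ n) g; lia.
Qed.

(** If the product g * g is not reduced then some x is a last letter of both g
    and g^-1, and the conjugate of g by x^-1 is shorter by two letters. *)
Lemma cyclic_reduction g : exists c g0, g = g0 ^ c /\ rprod g0 g0.
Proof.
have [n] := ubnP (len g); elim: n g => // n IH g gn.
have [gg|/not_rprod[x lx lVx]] := boolP (rprod g g); first by exists 1, g; rewrite conjg1.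
pose k := g * (letter x)^-1; have gE : g = k * letter x by rewrite mulgVK.
have r : rprod (letter x)^-1 k^-1 by apply: rprodV; exact: rprod_last.
have lk : last_letter k^-1 x.
  move: lVx; rewrite gE raagVM => /(last_rprod r)[//|[_ lx']].
  rewrite -letterV in lx'; have := last_of_letter lx'.
  by case: (x) => u [].
have [|c [g0 [E g0g0]]] := IH (letter x * k).
  have := len_pop lk; rewrite -raagVM !lenV; have := len_pop lx; rewrite -/k; lia.
exists (c * letter x), g0; split=> //.
by rewrite conjgM -E conjgE !mulgA mulVg mul1g.
Qed.

Lemma suffix_occ a b v : suffix a b -> (0 < occ v a)%N -> (0 < occ v b)%N.
Proof. by move=> /suffixP[y -> /rprod_occ->]; rewrite addn_gt0 orbC => ->. Qed.

Lemma suffix_len a b : suffix a b -> (len a <= len b)%N.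
Proof. by move=> /suffixP[y -> /rprodP->]; exact: leq_addl. Qed.

Lemma suffix1 a : suffix 1 a.
Proof. by rewrite /suffix; exact: rprod1. Qed.

Lemma suffix_pow g m n : rprod g g -> (m <= n)%N -> suffix (g ^+ m) (g ^+ n).
Proof.
by move=> gg mn; rewrite -(subnK mn) raagXD; apply/suffix_mul/rprod_pow2.
Qed.

Lemma orth_self g h : orth g h -> (forall v, 0 < occ v g -> 0 < occ v h)%N -> g = 1.
Proof.
move=> o gh; apply: contrapT => /occ_gt0[v vg].
by have := o v v vg (gh v vg); rewrite adjxx.
Qed.

(** A suffix of g ^+ n.+1 consists of a suffix t of the last copy of g and of a
    suffix s of g ^+ n that commutes with the rest y of that copy. *)
Lemma suffix_powS g n a : rprod g g -> suffix a (g ^+ n.+1) ->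
  exists s t (y : G), [/\ a = s * t, g = y * t, rprod s t & rprod y t] /\
    suffix s (g ^+ n) /\ orth s y.
Proof.
move=> gg /suffixP[z E za]; rewrite raagXSr in E.
have [y1 [y2 [s [t [[zE gE g'E aE] [_ ry1s ry2t rst] o]]]]] :=
  rprod_refine (esym E) za (rprod_pow n gg).
exists s, t, y2; split=> //; split=> //.
by rewrite gE; exact: suffix_mul.
Qed.

(** A suffix of g ^+ n that contains a letter of some copy of g contains letters
    of all the later copies, so it reaches at most len a copies. *)
Lemma suffix_pow_len g n a : rprod g g -> suffix a (g ^+ n) -> suffix a (g ^+ len a).
Proof.
move=> gg; elim: n a => [|n IH] a.
  rewrite expg0 => /suffix_len; rewrite len1 leqn0 => /eqP/len_eq0 ->; exact: suffix1.
move=> /(suffix_powS gg)[s [t [y [[aE gE st yt] [sgn o]]]]].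
have [t1|/eqP t1] := eqVneq t 1.
  suff -> : a = 1 by exact: suffix1.
  rewrite aE t1 mulg1; rewrite t1 mulg1 in gE; apply: orth_self o _ => v.
  by rewrite -gE => /(suffix_occ sgn)/occ_pow.
have lt : (0 < len t)%N by rewrite lt0n; apply/eqP => /len_eq0.
apply: (@suffix_trans _ (g ^+ (len s).+1)); last first.
  by apply: suffix_pow => //; rewrite aE (eqP st); lia.
have /suffixP[z E zs] := IH _ sgn.
have F : g ^+ (len s).+1 = z * y * a.
  rewrite raagXSr E gE aE -!mulgA; congr (_ * _).
  by rewrite !mulgA (orth_comm o).
have lenF : len (z * y * a) = (len z + len s + (len y + len t))%N.
  by rewrite -F raagXSr (eqP (rprod_pow _ gg)) E (eqP zs) gE (eqP yt).
rewrite F; apply: suffix_mul; apply/rprodP; rewrite lenF.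
have := lenM z y; have := lenM (z * y) a; rewrite lenF aE (eqP st); lia.
Qed.

(** * Elements with a common end have a common power *)

Lemma orth_split (S T : pred V) g : (forall u v, S u -> T v -> e u v) ->
  (forall v, 0 < occ v g -> S v || T v)%N ->
  exists a b, [/\ g = a * b, forall v, (0 < occ v a)%N -> S v &
                  forall v, (0 < occ v b)%N -> T v].
Proof.
move=> ST; elim/reduced_ind: g => [|g x nl IH] H.
  by exists 1, 1; rewrite mulg1; split=> // v; rewrite occ1.
have gx : rprod g (letter x) by rewrite rprod_letter.
have [|a [b [gE aS bT]]] := IH.
  by move=> v vg; apply: H; rewrite occ_push // addn_gt0 vg.
have := H x.1; rewrite occ_push // eqxx addn1 => /(_ isT)/orP[Sx|Tx].
- exists (a * letter x), b; split=> //.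
    rewrite gE -!mulgA; congr (_ * _); apply/esym/orth_comm/orth_letter => v /bT; exact: ST.
  move=> v; have := occM v a (letter x); rewrite occ_letter; case: eqVneq => [->//|_].
  by rewrite addn0 => le /leq_trans/(_ le)/aS.
- exists a, (b * letter x); split=> //; first by rewrite gE mulgA.
  move=> v; have := occM v b (letter x); rewrite occ_letter; case: eqVneq => [->//|_].
  by rewrite addn0 => le /leq_trans/(_ le)/bT.
Qed.

Definition unbounded_powers g := forall M, exists n, (M <= slen (g ^+ n))%N.

(** If the support of g were a join, every power of g would be a product of two
    elements, each in the star of a vertex on the other side. *)
Lemma unbounded_powers_not_join g (S : pred V) v w : unbounded_powers g ->
  (0 < occ v g)%N -> S v -> (0 < occ w g)%N -> ~~ S w ->
  exists p q, [/\ (0 < occ p g)%N, S p, (0 < occ q g)%N, ~~ S q & ~~ e p q].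
Proof.
move=> unb vg Sv wg Sw; apply: contrapT => no.
pose P := [pred u | (0 < occ u g)%N && S u]; pose Q := [pred u | (0 < occ u g)%N && ~~ S u].
have PQ p q : P p -> Q q -> e p q.
  move=> /andP[pg Sp] /andP[qg Sq]; apply: contrapT => /negP epq.
  by apply: no; exists p, q.
have [n Mn] := unb (2 * d).+1.
have [|a [b [gE aP bQ]]] := @orth_split P Q (g ^+ n) PQ.
  by move=> u /occ_pow; rewrite /= => ->; case: (S u).
have sa : star w a by move=> u /aP Pu; rewrite adjC PQ ?orbT //= wg.
have sb : star v b by move=> u /bQ Qu; rewrite PQ ?orbT //= vg.
have := slenM a b; rewrite -gE; have := slen_star sa; have := slen_star sb; lia.
Qed.

Definition supp g := [set v | (0 < occ v g)%N].

(** Remove the last copy of g from a. The support of what is left is strictly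
    smaller: if not, it would commute with the rest of that copy, which contains
    the other vertices of the support of g, and so g would be supported on a
    join. Hence a reaches at most as many copies of g as its support has
    elements. *)
Lemma suffix_pow_missing g w : rprod g g -> unbounded_powers g -> (0 < occ w g)%N ->
  forall k n a, suffix a (g ^+ n) -> (occ w a = 0)%N -> (#|supp a| <= k)%N ->
  (len a <= k * len g)%N.
Proof.
move=> gg unb wg; elim=> [|k IH] n a an wa ak.
  have [->|/eqP/occ_gt0[v va]] := eqVneq a 1; first by rewrite len1.
  by move: ak; rewrite leqn0 cards_eq0 => /eqP/setP/(_ v); rewrite !inE va.
case: n an => [|n] an.
  by have := suffix_len an; rewrite expg0 len1 leqn0 => /eqP->.
have [s [t [y [[aE gE st yt] [sgn o]]]]] := suffix_powS gg an.
have sa v : (0 < occ v s -> 0 < occ v a)%N by rewrite aE (rprod_occ _ st) addn_gt0 => ->.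
have ta v : (0 < occ v t -> 0 < occ v a)%N.
  by rewrite aE (rprod_occ _ st) addn_gt0 orbC => ->.
have tg : (len t <= len g)%N by rewrite gE (eqP yt) leq_addl.
have wy : (0 < occ w y)%N.
  move: wg wa; rewrite gE aE (rprod_occ _ yt) (rprod_occ _ st); lia.
have [lt|ge] := ltnP #|supp s| #|supp a|.
  have ws : occ w s = 0%N by apply/eqP; rewrite -leqn0 leqNgt; apply/negP => /sa; rewrite wa.
  have := IH n s sgn ws; rewrite aE (eqP st) mulSn; lia.
have E : supp s = supp a.
  by apply/eqP; rewrite eqEcard ge andbT; apply/fintype.subsetP => v; rewrite !inE; exact: sa.
have [->|/eqP/occ_gt0[v va]] := eqVneq a 1; first by rewrite len1.
have ag u : (0 < occ u a -> 0 < occ u g)%N by move=> /(suffix_occ an)/occ_pow.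
have [|p [q [pg Sp qg Sq epq]]] := @unbounded_powers_not_join g [pred u | 0 < occ u a]%N v w unb (ag _ va) va wg.
  by rewrite /= wa.
case/negP: epq; apply: o.
  by suff : p \in supp s; [rewrite inE | rewrite E inE].
move: Sq qg; rewrite gE (rprod_occ _ yt) /= -leqNgt leqn0 => /eqP qa.
have : occ q t = 0%N by apply/eqP; rewrite -leqn0 leqNgt; apply/negP => /ta; rewrite qa.
by move=> ->; rewrite addn0.
Qed.

(** The finiteness that makes the pigeonhole argument work, in place of
    acylindricity: only finitely many suffixes of powers of g do not end with g.
    Such a suffix misses a vertex of g after the removal of one copy of g. *)
Lemma suffix_pow_short g n a : rprod g g -> unbounded_powers g -> suffix a (g ^+ n) ->
  ~~ suffix g a -> (len a <= #|V|.+1 * len g)%N.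
Proof.
move=> gg unb; case: n => [|n].
  by move=> /suffix_len; rewrite expg0 len1 leqn0 => /eqP->.
move=> /(suffix_powS gg)[s [t [y [[aE gE st yt] [sgn o]]]]] nga.
have /occ_gt0[w wy] : y <> 1.
  by move=> y1; case/negP: nga; rewrite gE y1 mul1g aE; exact: suffix_mul.
have ws : occ w s = 0%N.
  apply/eqP; rewrite -leqn0 leqNgt; apply/negP => /o/(_ wy).
  by rewrite adjxx.
have wg : (0 < occ w g)%N by rewrite gE (rprod_occ _ yt) addn_gt0 wy.
have := suffix_pow_missing gg unb wg sgn ws (max_card _).
rewrite aE (eqP st) mulSn; have : (len t <= len g)%N by rewrite gE (eqP yt) leq_addl.
lia.
Qed.

(** For every i, the points v0 ^ (g ^+ n * h ^+ i) and v0 ^ (g ^+ m) have Gromov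
    products at v0 that tend to infinity (up to the factor 2): the power h ^+ i
    preserves the point of the boundary to which v0 ^ (g ^+ n) converges. *)
Definition same_end g h := forall i M, exists n0, forall n m, (n0 <= n)%N -> (n0 <= m)%N ->
  (M + slen ((g ^+ m : G) * ((g ^+ n : G) * h ^+ i)^-1)%g <= slen ((g ^+ n : G) * h ^+ i)%g + slen (g ^+ m))%N.

(** A cancellation with h reaches at most len h copies of g, so the first n - k
    copies remain intact. *)
Lemma suffix_translate g h k n : rprod g g -> (len h <= k <= n)%N ->
  suffix ((g ^+ k : G) * h) ((g ^+ n : G) * h).
Proof.
move=> gg /andP[hk kn].
have [a [z [b [gnE hE za ba no]]]] := common_suffix (g ^+ n) h^-1.
have zb := no_common_last no.
have ak : suffix a (g ^+ k).
  have := @suffix_pow_len g n a gg; rewrite {1}gnE => /(_ (suffix_mul za)) H.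
  apply: suffix_trans H (suffix_pow gg _); apply: leq_trans hk.
  by rewrite -(lenV h) hE (eqP ba) leq_addl.
have /suffixP[z' gkE z'a] := ak.
have nE : g ^+ n = (g ^+ (n - k) : G) * z' * a by rewrite -mulgA -gkE -raagXD subnK.
have zE : z = (g ^+ (n - k) : G) * z' by apply: (mulIg a); rewrite -gnE.
have rz : rprod (g ^+ (n - k)) z'.
  have := rprod_pow2 (n - k) k gg; rewrite gkE => /rprodA_r/(_ z'a)[]//.
have hE' : h = (a^-1 : G) * b^-1 by rewrite -raagVM -hE invgK.
have -> : (g ^+ n : G) * h = (g ^+ (n - k) : G) * (z' * b^-1).
  by rewrite nE hE' mulgA mulgK mulgA.
have -> : (g ^+ k : G) * h = z' * b^-1 by rewrite gkE hE' mulgA mulgK.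
by apply: suffix_mul; rewrite zE in zb; have [] := rprodA_l zb rz.
Qed.

(** The common suffix b of g ^+ n * h ^+ i and g ^+ m becomes arbitrarily long,
    while c is a fixed suffix of the former; by suffix_meet, c is a suffix of b
    and hence of g ^+ m. *)
Lemma same_end_suffix g h : rprod g g -> same_end g h ->
  forall i k, (len (h ^+ i) <= k)%N -> exists m, suffix ((g ^+ k : G) * h ^+ i) (g ^+ m).
Proof.
move=> gg gh i k ik; set c : G := (g ^+ k : G) * h ^+ i.
(* the constant makes slen b exceed slen c + 2 * d + 1 *)
have [n0 H] := gh i (2 * (slen c + 2 * d + 3) + d + 1)%N.
have cn : suffix c ((g ^+ maxn k n0 : G) * h ^+ i).
  by apply: suffix_translate; rewrite // ik leq_maxl.
have [b [bn bm bE]] := gromov_product_le ((g ^+ maxn k n0 : G) * h ^+ i) (g ^+ n0).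
have := H _ _ (leq_maxr k n0) (leqnn n0) => {}H.
have [a [ab ac alt]] := suffix_meet bn cn.
have sa : (slen a <= slen c + d.+1)%N.
  by have /suffixP[y cE ya] := ac; have := slen_rprod ya; rewrite -cE; lia.
exists n0; suff -> : c = a by exact: suffix_trans ab bm.
by case: alt => [[]|[E|E]] //; rewrite ?E in sa; lia.
Qed.

(** Take away from g ^+ k * h ^+ i as many copies of g as possible. What remains
    is a suffix of a power of g that does not end with g. *)
Lemma same_end_factor g h : rprod g g -> unbounded_powers g -> same_end g h ->
  forall i k, (len (h ^+ i) <= k)%N -> exists b j,
    (g ^+ k : G) * h ^+ i = b * (g ^+ j : G) /\ (len b <= #|V|.+1 * len g)%N.
Proof.
move=> gg unb gh i k ik; have [m cm] := same_end_suffix gg gh ik.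
set c : G := _ * _ in cm *.
have lg : (0 < len g)%N.
  rewrite lt0n; apply/eqP => /len_eq0 g1; have [n] := unb 1%N.
  by rewrite g1 expg1n slen1.
have ex : exists j, suffix (g ^+ j) c by exists 0%N; exact: suffix1.
have ub j : suffix (g ^+ j) c -> (j <= len c)%N.
  move=> /suffix_len; rewrite len_pow //; apply: leq_trans.
  by rewrite leq_pmulr.
case: (ex_maxnP ex ub) => j /suffixP[b cE bj] jmax.
exists b, j; split=> //.
have /suffixP[z mE zc] := cm.
have jm : (j <= m)%N.
  have := suffix_len cm; have : (len (g ^+ j) <= len c)%N by rewrite cE (eqP bj) leq_addl.
  rewrite !len_pow // => /leq_trans H /H; by rewrite leq_pmul2r.
have bE : g ^+ (m - j) = z * b.
  by apply: (mulIg (g ^+ j)); rewrite -raagXD subnK // mE cE mulgA.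
apply: (@suffix_pow_short g (m - j)) => //.
  rewrite bE; apply: suffix_mul; rewrite cE in zc.
  by have [] := rprodA_r zc bj.
apply/negP => /suffixP[b' b'E b'g].
suff : (j.+1 <= j)%N by rewrite ltnn.
apply: jmax; apply/suffixP; exists b'; first by rewrite expgS mulgA -b'E.
rewrite expgS; rewrite b'E in bj.
by have [] := rprodA_l bj b'g.
Qed.

(** With one k for all i <= N, two of the remainders of same_end_factor coincide
    by the pigeonhole principle; dividing one equation by the other leaves a
    power of h on one side and a power of g on the other. *)
Lemma reduced_same_end_power g h : rprod g g -> unbounded_powers g -> same_end g h ->
  exists i j j', (0 < i)%N /\ h ^+ i = ((g ^+ j)^-1 : G) * g ^+ j'.
Proof.
move=> gg unb gh; pose L := (#|V|.+1 * len g)%N.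
pose N := #|{: L.-bseq (V * bool)}|.
pose K := \max_(i < N.+1) len (h ^+ i).
have F (i : 'I_N.+1) : exists w : L.-bseq (V * bool), exists j,
    (g ^+ K : G) * h ^+ i = of_word w * (g ^+ j : G).
  have [|b [j [E bL]]] := same_end_factor gg unb gh (i := i) (k := K).
    exact: (leq_bigmax_cond (F := fun i : 'I_N.+1 => len (h ^+ i))).
  have [w [wb wL _]] := reduced_word b; rewrite -wL in bL.
  by exists (Bseq bL), j; rewrite E /= wb.
have [w wE] := fin_all_exists F.
have [i [i' [ii' wii']]] : exists i i' : 'I_N.+1, (i < i')%N /\ w i = w i'.
  apply: contrapT => no; have : injective w.
    move=> i i' E; apply: val_inj; case: (ltngtP i i') => // lt; case: no.
      by exists i, i'.
    by exists i', i.
  by move=> /leq_card; rewrite card_ord -/N ltnn.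
have [j E] := wE i; have [j' E'] := wE i'.
exists (i' - i)%N, j, j'; rewrite subn_gt0; split=> //.
apply: (mulgI (h ^+ i)); apply: (mulgI (g ^+ K)).
rewrite -raagXD subnKC ?(ltnW ii') // E' -wii' mulgA E.
by rewrite -!mulgA; congr (_ * _); rewrite mulVKg.
Qed.

Lemma slen_conj g c : (slen (g ^ c)%g <= slen g + 2 * slen c)%N.
Proof.
have -> : g ^ c = (c^-1 : G) * (g * c) by rewrite conjgE.
have := slenM c^-1 (g * c); have := slenM g c; rewrite slenV; lia.
Qed.

Lemma slen_conj_ge g c : (slen g <= slen (g ^ c)%g + 2 * slen c)%N.
Proof. by have := slen_conj (g ^ c) c^-1; rewrite conjgK slenV. Qed.

Lemma same_end_power g h : unbounded_powers g -> same_end g h ->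
  exists i j j', (0 < i)%N /\ h ^+ i = ((g ^+ j)^-1 : G) * g ^+ j'.
Proof.
move=> unb gh; have [c [g0 [gE g0g0]]] := cyclic_reduction g.
have [h0 hE] : exists h0, h = h0 ^ c by exists (h ^ c^-1); rewrite conjgKV.
have [||i [j [j' [i0 E]]]] := @reduced_same_end_power g0 h0 g0g0.
- move=> M; have [n Mn] := unb (M + 2 * slen c)%N; exists n.
  by move: Mn; rewrite gE raagXJ; have := slen_conj (g0 ^+ n) c; lia.
- move=> i M; have [n0 H] := gh i (M + 6 * slen c)%N; exists n0 => n m n0n n0m.
  have := H n m n0n n0m; rewrite gE hE !raagXJ raagMJ raagVJ raagMJ.
  have := slen_conj_ge ((g0 ^+ m : G) * ((g0 ^+ n : G) * h0 ^+ i)^-1) c.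
  have := slen_conj ((g0 ^+ n : G) * h0 ^+ i) c; have := slen_conj (g0 ^+ m) c; lia.
exists i, j, j'; split=> //.
by rewrite gE hE !raagXJ E raagVJ raagMJ.
Qed.

Lemma slen_pow_add g : exists C, forall m n,
  (slen (g ^+ m) + slen (g ^+ n) <= slen (g ^+ (m + n)) + C)%N.
Proof.
have [c [g0 [gE g0g0]]] := cyclic_reduction g.
exists (6 * slen c + d.+1)%N => m n; rewrite gE !raagXJ.
have := slen_rprod (rprod_pow2 m n g0g0); rewrite -raagXD.
have := slen_conj (g0 ^+ m) c; have := slen_conj (g0 ^+ n) c.
have := slen_conj_ge (g0 ^+ (m + n)) c; lia.
Qed.

End RightAngledArtinGroups.

Local Open Scope ring_scope.

(** * The sequential boundary of a hyperbolic metric *)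

(** The last field is the usual inequality between a Gromov product and the
    minimum of two others, written as a disjunction. *)
Record hyperbolic_metric (R : realType) (T : Type) (d : T -> T -> R) (delta : R) : Prop :=
  HyperbolicMetric {
    hyperbolic_xx : forall x, d x x = 0;
    hyperbolic_sym : forall x y, d x y = d y x;
    hyperbolic_triangle : forall y x z, d x z <= d x y + d y z;
    hyperbolic_product : forall o x y z,
      gromov_product d o x y <= gromov_product d o x z + delta \/
      gromov_product d o y z <= gromov_product d o x z + delta }.

(** A cyclic group of isometries F n, with inverses F' n, that moves o along a
    quasi-geodesic: by axis_add the orbit does not turn back. *)
Record quasi_axis (R : realType) (T : Type) (d : T -> T -> R)
    (F F' : nat -> T -> T) (o : T) (C : R) : Prop := QuasiAxis {
  axisK : forall n, cancel (F n) (F' n);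
  axisVK : forall n, cancel (F' n) (F n);
  axis_isom : forall n x y, d (F n x) (F n y) = d x y;
  axisD : forall m n x, F (m + n)%N x = F m (F n x);
  axis_add : forall m n, d o (F m o) + d o (F n o) <= d o (F (m + n)%N o) + C;
  axis_oo : forall M, exists N, forall n, (N <= n)%N -> M <= d o (F n o) }.

Section HyperbolicBoundary.
Local Open Scope classical_set_scope.
Context {R : realType} {T : Type} {d : T -> T -> R} {delta : R}.
Hypothesis hd : hyperbolic_metric d delta.
Let dxx := hyperbolic_xx hd.
Let dC := hyperbolic_sym hd.
Let d_triangle := hyperbolic_triangle hd.
Let gp := gromov_product d.
Let hyperbolic : forall o x y z,
  gp o x y <= gp o x z + delta \/ gp o y z <= gp o x z + delta := hyperbolic_product hd.

Implicit Types (x y z o : T) (u v w : nat -> T) (p q : gromov_boundary d) (M s t : R).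

Lemma d_ge0 x y : 0 <= d x y.
Proof. by have := d_triangle y x x; rewrite dxx (dC y x); lra. Qed.

Lemma delta_ge0 : forall x : T, 0 <= delta.
Proof. by move=> x; case: (hyperbolic x x x x); lra. Qed.

Lemma gpC o x y : gp o x y = gp o y x.
Proof. by rewrite /gp /gromov_product (dC x y) (addrC (d o x)). Qed.

Lemma hyperbolic_le o x y z M : M <= gp o x y -> M <= gp o y z -> M - delta <= gp o x z.
Proof. by case: (hyperbolic o x y z); lra. Qed.

Lemma hyperbolic3_le o x y z (z' : T) M : M <= gp o x y -> M <= gp o y z -> M <= gp o z z' ->
  M - 2 * delta <= gp o x z'.
Proof.
move=> h1 h2 h3; have h4 := hyperbolic_le h2 h3; have := delta_ge0 o => d0.
have : M - delta <= gp o x y by lra.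
by move=> /hyperbolic_le/(_ h4); lra.
Qed.

Lemma gp_base o o' x y : gp o x y <= gp o' x y + d o o'.
Proof.
rewrite /gp /gromov_product; have := d_triangle o' o x; have := d_triangle o' o y; lra.
Qed.

Definition gp_ge o u v M := exists N, forall i j, (N <= i)%N -> (N <= j)%N ->
  M <= gp o (u i) (v j).

Lemma gp_geW o u v M M' : M' <= M -> gp_ge o u v M -> gp_ge o u v M'.
Proof. by move=> MM [N H]; exists N => i j Ni Nj; apply: le_trans (H i j Ni Nj). Qed.

Lemma gp_geC o u v M : gp_ge o u v M -> gp_ge o v u M.
Proof. by move=> [N H]; exists N => i j Ni Nj; rewrite gpC; exact: H. Qed.

Lemma gp_ge_trans o u v w M : gp_ge o u v M -> gp_ge o v w M -> gp_ge o u w (M - delta).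
Proof.
move=> [N1 H1] [N2 H2]; exists (maxn N1 N2) => i j; rewrite !geq_max => /andP[? ?] /andP[? ?].
by apply: (@hyperbolic_le _ _ (v (maxn N1 N2)));
  [apply: H1 | apply: H2]; rewrite // ?leq_maxl ?leq_maxr.
Qed.

Lemma liminf_product_ge o u v M : gp_ge o u v M -> (M%:E <= liminf_product d o u v)%E.
Proof.
move=> [N H]; rewrite /liminf_product limf_einfE.
pose A := [set ij : nat * nat | (N <= ij.1)%N /\ (N <= ij.2)%N].
apply: (@le_trans _ _ (ereal_inf ((fun ij : nat * nat =>
  (gromov_product d o (u ij.1) (v ij.2))%:E) @` A))).
  by apply: le_ereal_inf_tmp => _ [[i j] [/= Ni Nj] <-]; rewrite lee_fin; exact: H.
apply: ereal_sup_ubound; exists A => //.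
exists ([set i | (N <= i)%N], [set j | (N <= j)%N]) => /=.
  by split; exists N.
by move=> [i j] [].
Qed.

Lemma liminf_product_gt o u v M : (M%:E < liminf_product d o u v)%E -> gp_ge o u v M.
Proof.
rewrite /liminf_product limf_einfE => /ereal_sup_gt[_ [A [[P Q] /= [[N1 _ P1] [N2 _ Q2]] PQA] <-]].
move=> MA; exists (maxn N1 N2) => i j; rewrite !geq_max => /andP[? ?] /andP[? ?].
rewrite -lee_fin; apply: le_trans (ltW MA) _; apply: ereal_inf_lbound.
by exists (i, j) => //; apply: PQA; split; [exact: P1 | exact: Q2].
Qed.

Lemma liminf_product_oo o u v : liminf_product d o u v = +oo%E <-> forall M, gp_ge o u v M.
Proof.
split=> [E M|H]; first by apply: liminf_product_gt; rewrite E ltry.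
by apply/eq_infty => M; exact: liminf_product_ge.
Qed.

Lemma boundary_equivP o u v : boundary_equiv d u v <-> forall M, gp_ge o u v M.
Proof.
split=> [/(_ o)/liminf_product_oo//|H o']; apply/liminf_product_oo => M.
have [N HN] := H (M + d o o'); exists N => i j Ni Nj.
by have := HN i j Ni Nj; have := gp_base o o' (u i) (v j); lra.
Qed.

Lemma cvg_at_infinityP o u : cvg_at_infinity d u <-> forall M, gp_ge o u u M.
Proof. exact: boundary_equivP. Qed.

Lemma boundary_equivC u v : boundary_equiv d u v -> boundary_equiv d v u.
Proof.
by move=> H; apply/(boundary_equivP (u 0%N)) => M; apply: gp_geC; move: M; exact/boundary_equivP.
Qed.

Lemma boundary_equiv_trans u v w :
  boundary_equiv d u v -> boundary_equiv d v w -> boundary_equiv d u w.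
Proof.
move=> /(boundary_equivP (u 0%N)) H1 /(boundary_equivP (u 0%N)) H2.
apply/(boundary_equivP (u 0%N)) => M; rewrite -[M](addrK delta).
exact: gp_ge_trans (H1 _) (H2 _).
Qed.

Lemma boundary_equiv_close u v b :
  cvg_at_infinity d u -> (forall n, d (u n) (v n) <= b) -> boundary_equiv d u v.
Proof.
move=> /(cvg_at_infinityP (u 0%N)) cu uv; apply/(boundary_equivP (u 0%N)) => M.
have [N H] := cu (M + b); exists N => i j Ni Nj; have := H i j Ni Nj; have := uv j.
rewrite /gp /gromov_product; have := d_triangle (v j) (u 0%N) (u j).
have := d_triangle (u j) (u i) (v j); rewrite (dC (v j) (u j)); lra.
Qed.

Definition boundary_point u (cu : cvg_at_infinity d u) : gromov_boundary d :=
  exist _ (boundary_class d u) (ex_intro2 _ _ u cu erefl).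

Lemma boundary_rep p : exists u, sval p u.
Proof. by case: p => _ /= [u cu ->]; exists u; split. Qed.

Lemma boundary_point_rep u (cu : cvg_at_infinity d u) : sval (boundary_point cu) u.
Proof. by split. Qed.

Lemma boundary_rep_equiv p u v : sval p u -> sval p v -> boundary_equiv d u v.
Proof.
case: p => _ /= [w cw ->] [_ wu] [_ wv].
exact: boundary_equiv_trans (boundary_equivC wu) wv.
Qed.

Lemma boundary_classE p u : sval p u -> sval p = boundary_class d u.
Proof.
have [w cw ->] := svalP p => -[cu wu]; apply/seteqP; split=> v [cv H]; split=> //.
  exact: boundary_equiv_trans (boundary_equivC wu) H.
exact: boundary_equiv_trans wu H.
Qed.

Lemma boundary_eqP p q u v : sval p u -> sval q v -> boundary_equiv d u v -> p = q.
Proof.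
move=> /boundary_classE pu qv uv.
have {}pu : sval p v by rewrite pu; case: (svalP q) qv => w _ -> [cv _]; split.
have E : sval p = sval q by rewrite (boundary_classE pu) (boundary_classE qv).
by case: p q E {pu qv} => [S hS] [S' hS'] /= E; exact: eq_exist.
Qed.

(* what a Gromov product can lose when the representatives of two boundary
   points are changed *)
Let c := 1 + 2 * delta.

(** A ball is defined by one pair of sequences. For all other pairs the Gromov
    products can drop by a constant only. *)
Lemma boundary_ballP o p s q u v : boundary_ball o p s q -> sval p u -> sval q v ->
  gp_ge o u v (s - c).
Proof.
move=> [u' [v' [pu' qv' suv]]] pu qv.
have uu' : gp_ge o u u' (s - 1).
  exact: (proj1 (boundary_equivP _ _ _) (boundary_rep_equiv pu pu')).
have v'v : gp_ge o v' v (s - 1).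
  exact: (proj1 (boundary_equivP _ _ _) (boundary_rep_equiv qv' qv)).
have u'v' : gp_ge o u' v' (s - 1).
  by apply: liminf_product_gt; apply: lt_le_trans suv; rewrite lte_fin; lra.
have uv' := gp_ge_trans uu' u'v'; have := delta_ge0 o => d0.
have {}v'v : gp_ge o v' v (s - 1 - delta) by apply: gp_geW v'v; lra.
by apply: gp_geW (gp_ge_trans uv' v'v); rewrite /c; lra.
Qed.

Lemma boundary_ballI o p s q u v : sval p u -> sval q v -> gp_ge o u v s ->
  boundary_ball o p s q.
Proof. by move=> pu qv uv; exists u, v; split=> //; exact: liminf_product_ge. Qed.

Lemma boundary_ball_center o p s : boundary_ball o p s p.
Proof.
have [u pu] := boundary_rep p; apply: (boundary_ballI pu pu).
exact: (proj1 (boundary_equivP _ _ _) (boundary_rep_equiv pu pu)).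
Qed.

Lemma boundary_ballW o p s t q : t <= s -> boundary_ball o p s q -> boundary_ball o p t q.
Proof.
move=> ts [u [v [pu qv H]]]; exists u, v; split=> //.
by apply: le_trans H; rewrite lee_fin.
Qed.

Lemma boundary_ball_trans o p q q' s :
  boundary_ball o p (s + c + delta) q -> boundary_ball o q (s + c + delta) q' ->
  boundary_ball o p s q'.
Proof.
have [u pu] := boundary_rep p; have [v qv] := boundary_rep q.
have [w qw] := boundary_rep q'.
move=> /boundary_ballP/(_ pu qv) H1 /boundary_ballP/(_ qv qw) H2.
apply: (boundary_ballI pu qw); apply: gp_geW (gp_ge_trans H1 H2); lra.
Qed.

Lemma boundary_ball_base o o' p s q :
  boundary_ball o' p (s + c + d o' o) q -> boundary_ball o p s q.
Proof.
have [u pu] := boundary_rep p; have [v qv] := boundary_rep q.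
move=> /boundary_ballP/(_ pu qv)[N H]; apply: (boundary_ballI pu qv); exists N => i j Ni Nj.
by have := H i j Ni Nj; have := gp_base o' o (u i) (v j); lra.
Qed.

Lemma boundary_openP o (U : set (gromov_boundary d)) :
  open U <-> forall p, U p -> exists s, boundary_ball o p s `<=` U.
Proof.
have -> : open U = boundary_open U by [].
split=> [oU p Up|H p Up o']; first exact: oU.
have [s sU] := H p Up; exists (s + c + d o' o) => q /boundary_ball_base; exact: sU.
Qed.

(** Having a whole ball around q disjoint from the ball around p makes this set
    open, whereas the balls themselves need not be. *)
Definition far_from o p M : set (gromov_boundary d) :=
  [set q | exists t, forall q', boundary_ball o q t q' -> ~ boundary_ball o p M q'].

Lemma open_far_from o p M : open (far_from o p M).
Proof.
apply/(boundary_openP o) => q [t qt]; exists (t + c + delta) => q' qq'.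
by exists (t + c + delta) => q'' q'q''; apply: qt; exact: boundary_ball_trans qq' q'q''.
Qed.

Lemma far_fromN o p M q : far_from o p M q -> ~ boundary_ball o p M q.
Proof. by move=> [t]; apply; exact: boundary_ball_center. Qed.

Lemma far_fromW o p M M' : M <= M' -> far_from o p M `<=` far_from o p M'.
Proof. by move=> MM q [t qt]; exists t => q' /qt H /(boundary_ballW MM). Qed.

Lemma neq_far_from o p q : q <> p -> exists M, far_from o p M q.
Proof.
have [u pu] := boundary_rep p; have [v qv] := boundary_rep q => qp.
apply: contrapT => no; apply/qp/esym/(boundary_eqP pu qv)/(boundary_equivP o) => M.
have [q' [H1 H2]] : exists q', boundary_ball o q (M + c + delta) q' /\
    boundary_ball o p (M + c + delta) q'.
  apply: contrapT => no'; apply: no; exists (M + c + delta), (M + c + delta) => q' H1 H2.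
  by apply: no'; exists q'.
have [w qw] := boundary_rep q'.
have K1 := boundary_ballP H2 pu qw; have K2 := gp_geC (boundary_ballP H1 qv qw).
by apply: gp_geW (gp_ge_trans K1 K2); lra.
Qed.

Lemma boundary_T1 o p q : p <> q -> exists U : set (gromov_boundary d),
  [/\ open U, U p & ~ U q].
Proof.
move=> /(neq_far_from o)[M pM]; exists (far_from o q M); split=> //.
  exact: open_far_from.
by move=> /far_fromN; apply; exact: boundary_ball_center.
Qed.

Lemma compact_increasing_cover (X : topologicalType) (K : set X) (W : nat -> set X) :
  compact K -> (forall n, open (W n)) -> (forall m n, (m <= n)%N -> W m `<=` W n) ->
  K `<=` \bigcup_n W n -> exists n, K `<=` W n.
Proof.
move=> cK oW mW KW; apply: contrapT => no.
have ne n : (K `\` W n) !=set0.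
  apply: contrapT => /set0P/negP; rewrite negbK => /eqP; rewrite setD_eq0 => KWn.
  apply: no.
  by exists n.
have FF : Filter (filter_from [set: nat] (fun n => K `\` W n)).
  apply: filter_from_filter; first by exists 0%N.
  move=> i j _ _; exists (maxn i j) => // x [Kx nW]; split; split=> //.
    by move=> /(mW i (maxn i j) (leq_maxl _ _)).
  by move=> /(mW j (maxn i j) (leq_maxr _ _)).
have PF : ProperFilter (filter_from [set: nat] (fun n => K `\` W n)).
  exact: filter_from_proper.
have [|x [Kx cx]] := cK _ PF; first by exists 0%N => // x [].
have [n _ Wnx] := KW x Kx.
have [|y [[_ nWy] Wy]] := cx (K `\` W n) (W n) _ (open_nbhs_nbhs (conj (oW n) Wnx)).
  by exists n.
exact: nWy.
Qed.

(** The sets far_from o p M increase with M and cover the complement of p. *)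
Lemma compact_far_from o p K : compact K -> ~ K p -> exists M, K `<=` far_from o p M.
Proof.
move=> cK nKp; have [|||n Kn] := @compact_increasing_cover _ K (fun n => far_from o p n%:R) cK.
- by move=> n; exact: open_far_from.
- by move=> m n mn; apply: far_fromW; rewrite ler_nat.
- move=> q Kq; have [|M qM] := @neq_far_from o p q; first by move=> qp; rewrite qp in Kq.
  exists (Num.truncn M).+1 => //; apply: far_fromW qM; apply: ltW; exact: truncnS_gt.
by exists n%:R.
Qed.

(** * Quasi-axes act with north-south dynamics *)

Section Dynamics.
Context {F F' : nat -> T -> T} {o : T} {C : R}.
Hypothesis hF : quasi_axis d F F' o C.
Let FK := axisK hF.
Let F'K := axisVK hF.
Let F_isom := axis_isom hF.
Let FD := axisD hF.
Let a_oo := axis_oo hF.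
Let a n := d o (F n o).
Let a_add : forall m n, a m + a n <= a (m + n)%N + C := axis_add hF.
Let up n := F n o.
Let um n := F' n o.

Lemma F'_isom n x y : d (F' n x) (F' n y) = d x y.
Proof. by rewrite -(F_isom n) !F'K. Qed.

Lemma F'D m n x : F' (m + n)%N x = F' m (F' n x).
Proof. by rewrite -{1}(F'K n x) -{1}(F'K m (F' n x)) -FD addnC FK. Qed.

Lemma a_F' n : d o (F' n o) = a n.
Proof. by rewrite -(F_isom n) F'K dC. Qed.

Lemma gp_orbit (f : nat -> T -> T) : (forall n x y, d (f n x) (f n y) = d x y) ->
  (forall m n x, f (m + n)%N x = f m (f n x)) -> (forall n, d o (f n o) = a n) ->
  forall m n M, M + C <= a m -> M + C <= a n -> M <= gp o (f m o) (f n o).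
Proof.
move=> f_isom fD fa; have C0 : 0 <= C.
  by have := a_add 0 0; rewrite addn0; have := d_ge0 o (F 0%N o); rewrite -/(a 0%N); lra.
have le m n M : (m <= n)%N -> M + C <= a m -> M + C <= a n -> M <= gp o (f m o) (f n o).
  move=> mn hm hn; have := a_add m (n - m); rewrite subnKC // => H.
  have E : d (f m o) (f n o) = a (n - m) by rewrite -{1}(subnKC mn) fD f_isom fa.
  rewrite /gp /gromov_product !fa E; lra.
move=> m n M hm hn; case: (leqP m n) => [|/ltnW] mn; first exact: le.
by rewrite gpC; exact: le.
Qed.

Lemma gp_up m n M : M + C <= a m -> M + C <= a n -> M <= gp o (up m) (up n).
Proof. exact: gp_orbit. Qed.

Lemma gp_um m n M : M + C <= a m -> M + C <= a n -> M <= gp o (um m) (um n).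
Proof. by apply: gp_orbit; [exact: F'_isom | exact: F'D | exact: a_F']. Qed.

Lemma gp_up_um m n : gp o (up m) (um n) <= C.
Proof.
have := a_add m n; have -> : a (m + n) = d (up m) (um n).
  by rewrite /a addnC FD -(F_isom n (up m)) /um F'K dC.
have := d_ge0 (up m) (um n).
rewrite /gp /gromov_product a_F' -/(a m) => _ H.
have C0 : 0 <= C.
  by have := a_add 0 0; rewrite addn0; have := d_ge0 o (F 0%N o); rewrite -/(a 0%N); lra.
lra.
Qed.

Lemma cvg_up : cvg_at_infinity d up.
Proof.
apply/(cvg_at_infinityP o) => M; have [N aN] := a_oo (M + C); exists N => i j Ni Nj.
by apply: gp_up; exact: aN.
Qed.

Variables pp pm : gromov_boundary d.
Hypotheses (pp_up : sval pp up) (pm_um : sval pm um).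

Lemma axis_ends_neq : pp <> pm.
Proof.
move=> E; have H := pm_um; rewrite -E in H.
have /(boundary_equivP o)/(_ (C + 1))[N HN] := boundary_rep_equiv pp_up H.
by have := HN N N (leqnn N) (leqnn N); have := gp_up_um N N; lra.
Qed.

(** Let v represent q. As q is not in the ball around the repelling point, v j
    has a small Gromov product with um N for large j. The isometry F N carries
    um N to o and o to up N, so the Gromov product of F N (v j) and up N at o is
    a N minus a small number. *)
Lemma attract M s : exists2 N0, (0 < N0)%N & forall N q q', (N0 <= N)%N ->
  ~ boundary_ball o pm M q ->
  (forall v, sval q v -> sval q' (F N \o v)) ->
  boundary_ball o pp s q'.
Proof.
have d0 := delta_ge0 o.
(* large enough for the bounds with s and with M below *)
pose L := `|s| + `|M| + 3 * delta + C + 1.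
have [N0 aN0] := a_oo L; exists N0.+1 => // N q q' N0N qM qq'.
have aN n : (N <= n)%N -> L <= a n by move=> Nn; apply/aN0/(leq_trans _ Nn)/ltnW.
have [sL ML] : s + delta + C <= L /\ M + 3 * delta + C <= L /\ s + 3 * delta + M <= L.
  rewrite /L; have := ler_norm s; have := ler_norm M.
  have := normr_ge0 s; have := normr_ge0 M.
  have C0 : 0 <= C.
    by have := a_add 0 0; rewrite addn0; have := d_ge0 o (F 0%N o); rewrite -/(a 0%N); lra.
  by split; [|split]; lra.
have [v qv] := boundary_rep q.
have cv := boundary_rep_equiv qv qv.
have [J HJ] := proj1 (boundary_equivP o v v) cv (M + 2 * delta).
have small j : (J <= j)%N -> gp o (um N) (v j) <= M + 2 * delta.
  move=> Jj; rewrite leNgt; apply/negP => big; apply: qM.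
  apply: (boundary_ballI pm_um qv); exists (maxn N J) => i j'.
  rewrite !geq_max => /andP[Ni Ji] /andP[Nj' Jj'].
  rewrite -[M](addrK (2 * delta)); apply: hyperbolic3_le (ltW big) (HJ _ _ Jj Jj').
  by apply: gp_um; [have := aN _ Ni | have := aN _ (leqnn N)]; lra.
apply: (boundary_ballI pp_up (qq' _ qv)); exists (maxn N J) => i j.
rewrite !geq_max => /andP[Ni Ji] /andP[Nj Jj].
rewrite -[s](addrK delta); apply: (@hyperbolic_le _ _ (up N)).
  by apply: gp_up; [have := aN _ Ni | have := aN _ (leqnn N)]; lra.
have := small _ Jj; have := aN _ (leqnn N).
have E : d o (F N (v j)) = d (um N) (v j) by rewrite -[RHS](F_isom N) F'K.
rewrite /gp /gromov_product /= (a_F' N) E /up F_isom -/(a N); lra.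
Qed.
End Dynamics.
End HyperbolicBoundary.

(** * Loxodromic elements on the boundary of the extension graph *)

Section Loxodromic.
Local Open Scope classical_set_scope.
Context {R : realType} {V : finType} {e : rel V}.
Hypotheses (e_simple : simple_graph e) (e_conn : connected_graph e).
Variable v0 : V.
Let G := raag e.
Let T := ext_vertex e.
Let d : T -> T -> R := @ext_distR V e R.
Let o : T := gen_vertex v0.
Let pt (g : G) : T := conj_vertex v0 g.
Implicit Types (g h : G) (x y z : T) (p q : ext_boundary e R).

Let delta : R := (@hyp_const V)%:R.

Lemma ext_hyperbolic : hyperbolic_metric d delta.
Proof.
split; rewrite /d /ext_distR.
- by move=> x; rewrite ext_distxx.
- by move=> x y; rewrite (ext_distC e_simple e_conn).
- by move=> y x z; rewrite -natrD ler_nat (ext_dist_triangle e_simple e_conn).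
move=> w x y z; have := ext_four_points e_simple e_conn v0 w x y z.
rewrite /delta /gromov_product; move: (@hyp_const V) => D.
have D0 : 0 <= D%:R :> R by [].
by case=> H; [left|right]; move: H; rewrite -(ler_nat R) !natrD; lra.
Qed.
Let hd := ext_hyperbolic.

Definition diverges g := forall M : nat, exists N, forall n, (N <= n)%N ->
  (M <= slen v0 (g ^+ n)%g)%N.

Lemma loxodromic_diverges g : loxodromic R g -> diverges g.
Proof.
move=> /(_ o)[l l0 cl] M.
have [|N _ HN] := (cvgr_gt _ cl) (l / 2); first by lra.
pose K := (Num.truncn (M%:R * 2 / l)).+1.
exists (maxn N K).+1 => n; rewrite gtn_max => /andP[Nn Kn].
have n0 : 0 < n%:R :> R by rewrite ltr0n (leq_ltn_trans _ Nn).
have := HN n (ltnW Nn); rewrite /= ltr_pdivlMr // -/(conj_vertex v0 (g ^+ n)%g) -/(slen v0 _) => H.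
rewrite -(ler_nat R); apply: ltW; apply: le_lt_trans H.
have := truncnS_gt (M%:R * 2 / l); rewrite -/K => H.
have : K%:R <= n%:R :> R by rewrite ler_nat ltnW.
move=> /(lt_le_trans H); rewrite ltr_pdivrMr //.
nra.
Qed.

Lemma divergesV g : diverges g -> diverges (g^-1)%g.
Proof.
move=> ub M; have [N HN] := ub M; exists N => n /HN; rewrite expVgn.
by rewrite slenV.
Qed.

Lemma diverges_unbounded_powers g : diverges g -> unbounded_powers v0 g.
Proof. by move=> ub M; have [N HN] := ub M; exists N; exact: HN. Qed.

Let F g n : T -> T := ext_conj (g ^+ n)%g.
Let F' g n : T -> T := ext_conj (g ^- n)%g.

Lemma diverges_axis g : diverges g -> exists C, quasi_axis d (F g) (F' g) o C.
Proof.
move=> ub; have [C HC] := slen_pow_add e_simple e_conn v0 g; exists C%:R; split.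
- by move=> n; exact: ext_conjK.
- by move=> n; exact: ext_conjKV.
- by move=> n x y; exact: ext_distRJ.
- by move=> m n x; rewrite /F -ext_conjM addnC expgnDr.
- by move=> m n; rewrite /d /ext_distR -!natrD ler_nat; exact: HC.
move=> M; have [N HN] := ub (Num.truncn M).+1; exists N => n /HN H.
by apply: ltW; apply: lt_le_trans (truncnS_gt M) _; rewrite ler_nat.
Qed.

Definition orbit_seq g : nat -> T := fun n => pt (g ^+ n)%g.

Lemma orbit_seqV g : orbit_seq g^-1%g = (fun n => F' g n o).
Proof. by apply/funext => n; rewrite /orbit_seq expVgn. Qed.

Lemma orbit_seq_cvg g : diverges g -> cvg_at_infinity d (orbit_seq g).
Proof. by move=> /diverges_axis[C hF]; exact: (cvg_up hd hF). Qed.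

Lemma attractor_exists g : diverges g -> exists p, sval p (orbit_seq g).
Proof.
by move=> /orbit_seq_cvg cg; exists (boundary_point cg); exact: boundary_point_rep.
Qed.

Lemma boundary_act_rep g p u : sval p u -> sval (boundary_act g p) (ext_conj g \o u).
Proof. by move=> pu; exists u. Qed.

Lemma boundary_actM g h p : boundary_act (g * h)%g p = boundary_act h (boundary_act g p).
Proof.
have [u pu] := boundary_rep p.
have H := boundary_act_rep h (boundary_act_rep g pu).
apply: (boundary_eqP hd (boundary_act_rep (g * h)%g pu) H).
have -> : ext_conj (g * h)%g \o u = ext_conj h \o (ext_conj g \o u).
  by apply/funext => n; rewrite /= ext_conjM.
exact: (boundary_rep_equiv hd H H).
Qed.

Lemma boundary_act1 p : boundary_act 1%g p = p.
Proof.
have [u pu] := boundary_rep p; apply: (boundary_eqP hd (boundary_act_rep 1%g pu) pu).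
have -> : ext_conj 1%g \o u = u by apply/funext => n; rewrite /= ext_conj1.
exact: (boundary_rep_equiv hd pu pu).
Qed.

Lemma boundary_act_inj g : injective (@boundary_act V e R g).
Proof.
move=> p q E; rewrite -(boundary_act1 p) -(boundary_act1 q) -(mulgV g) !boundary_actM.
by rewrite E.
Qed.

Lemma boundary_act_fixX g p n : boundary_act g p = p -> boundary_act (g ^+ n)%g p = p.
Proof.
by move=> gp; elim: n => [|n IH]; [exact: boundary_act1 | rewrite expgS boundary_actM gp].
Qed.

Lemma boundary_act_fixV g p : boundary_act g p = p -> boundary_act g^-1%g p = p.
Proof. by move=> gp; rewrite -{1}gp -boundary_actM mulgV boundary_act1. Qed.

Lemma attractor_fixed g p : diverges g -> sval p (orbit_seq g) -> boundary_act g p = p.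
Proof.
move=> ub pg; apply/esym/(boundary_eqP hd pg (boundary_act_rep g pg)).
apply: (boundary_equiv_close hd (b := (slen v0 g)%:R) (orbit_seq_cvg ub)) => n.
rewrite /d /ext_distR /= ler_nat /orbit_seq /pt /conj_vertex -ext_conjM.
by rewrite slen_conj_vertex -expgSr expgS mulgK.
Qed.

(** In this section pp and pm are the limits of the positive and of the negative
    powers of g. *)
Section Poles.
Variables (g : G) (ub : diverges g) (pp pm : ext_boundary e R).
Hypotheses (pp_g : sval pp (orbit_seq g)) (pm_g : sval pm (orbit_seq g^-1%g)).

Lemma poles_neq : pp <> pm.
Proof.
have [C hF] := diverges_axis ub.
by apply: (axis_ends_neq hd hF pp_g); rewrite -orbit_seqV.
Qed.

Lemma attracting_fixed : boundary_act g pp = pp. Proof. exact: attractor_fixed. Qed.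

Lemma repelling_fixed : boundary_act g pm = pm.
Proof.
by rewrite -{1}(invgK g); apply/boundary_act_fixV/attractor_fixed => //; exact: divergesV.
Qed.

Lemma attract_far M s : exists2 N0, (0 < N0)%N & forall N q, (N0 <= N)%N ->
  ~ boundary_ball o pm M q -> boundary_ball o pp s (boundary_act (g ^+ N)%g q).
Proof.
have [C hF] := diverges_axis ub.
have pm_um : sval pm (fun n => F' g n o) by rewrite -orbit_seqV.
have [N0 N00 H] := attract hd hF pp_g pm_um M s; exists N0 => // N q N0N qM.
by apply: (H N q _ N0N qM) => v; exact: boundary_act_rep.
Qed.

Lemma north_south : attracting_repelling g pp pm.
Proof.
move=> K U cK Kpm oU Upp.
have [|M KM] := compact_far_from hd o (p := pm) cK; first by move=> /Kpm /(_ erefl).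
have [s sU] := proj1 (boundary_openP hd o U) oU _ Upp.
have [N N0 H] := attract_far M s; exists N => // _ [q Kq <-].
by apply: sU; apply: H => //; exact: (far_fromN hd (KM _ Kq)).
Qed.

Lemma T1_eq p q : (forall U : set (ext_boundary e R), open U -> U p -> U q) -> p = q.
Proof.
move=> H; apply: contrapT => /(boundary_T1 hd o)[U [oU Up nUq]].
by apply: nUq; apply: H.
Qed.

(** Apply the property to the compact set that consists of x only: every
    neighbourhood of qp contains x. *)
Lemma attracting_repelling_fixed (qp qm x : ext_boundary e R) :
  attracting_repelling g qp qm -> boundary_act g x = x -> x <> qm -> qp = x.
Proof.
move=> ar gx xqm; apply: T1_eq => U oU Uqp.
have [|N _ /(_ x)] := ar [set x] U (@compact_set1 _ x) _ oU Uqp.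
  by move=> y ->.
by apply; exists x => //; exact: boundary_act_fixX.
Qed.

Lemma fixed_point q : boundary_act g q = q -> q = pp \/ q = pm.
Proof.
move=> gq; have [->|qpm] := pselect (q = pm); [by right | left].
exact/esym/(attracting_repelling_fixed north_south).
Qed.

(** By attract_far all but finitely many translates of x lie in a ball around pp
    that is far from pm, and each of the others differs from pm. *)
Lemma avoid_orbit (x : ext_boundary e R) : x <> pp -> x <> pm -> exists U : set (ext_boundary e R),
  [/\ open U, U pm & forall N, (0 < N)%N -> ~ U (boundary_act (g ^+ N)%g x)].
Proof.
move=> xpp xpm; have [M pmM] := neq_far_from hd o (nesym poles_neq).
have [L xL] := neq_far_from hd o xpm.
have [N0 _ H] := attract_far L M.
have [U [oU Upm nU]] : exists U : set (ext_boundary e R), [/\ open U, U pm &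
    forall N, (0 < N < N0)%N -> ~ U (boundary_act (g ^+ N)%g x)].
  elim: N0 {H} => [|n [U [oU Upm nU]]].
    by exists setT; split=> [||N]; [exact: openT | by [] | rewrite ltn0 andbF].
  have [|W [oW Wpm nW]] := @boundary_T1 _ _ _ _ hd o pm (boundary_act (g ^+ n)%g x).
    move=> E; apply: xpm; apply: (@boundary_act_inj (g ^+ n)%g).
    by rewrite -E boundary_act_fixX //; exact: repelling_fixed.
  exists (U `&` W); split=> [||N /andP[N0 Nn] [UN WN]]; [exact: openI | by [] |].
  move: Nn; rewrite ltnS leq_eqVlt => /orP[/eqP NE|Nn]; first by rewrite NE in WN.
  by apply: (nU N) => //; rewrite N0.
exists (U `&` far_from o pp M); split=> [||N N1 [UN /(far_fromN hd)]]; last 1 first.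
- have [N0N|NN0] := leqP N0 N; last by case: (nU N) => //; rewrite N1.
  by apply; apply: H => //; exact: (far_fromN hd xL).
- by apply: openI => //; exact: (open_far_from hd).
- by [].
Qed.

(** By attracting_repelling_fixed, a pair with the same property is (pp, pm) or
    (pm, pp). The third point x excludes the latter, because its translates by
    positive powers stay away from pm; on a boundary with two points only, both
    pairs would have the property. *)
Lemma poles_unique (x qp qm : ext_boundary e R) : x <> pp -> x <> pm -> attracting_repelling g qp qm ->
  qp = pp /\ qm = pm.
Proof.
move=> xpp xpm ar; have [qpm|qpm] := pselect (pm = qm).
  by split=> //; apply: attracting_repelling_fixed ar attracting_fixed _; rewrite -qpm; exact: poles_neq.
have qpE := attracting_repelling_fixed ar repelling_fixed qpm.
have qmE : pp = qm.
  apply: contrapT => ppqm; apply: poles_neq.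
  by rewrite -qpE; apply/esym/(attracting_repelling_fixed ar attracting_fixed).
have [U [oU Upm nU]] := avoid_orbit xpp xpm.
have xqm : [set x] `<=` ~` [set qm] by move=> y ->; rewrite /= -qmE.
have [|N N0 H] := ar [set x] U (@compact_set1 _ x) xqm oU; first by rewrite qpE.
by case: (nU N N0); apply: H; exists x.
Qed.

End Poles.
Lemma common_end g h p : diverges g -> sval p (orbit_seq g) -> boundary_act h p = p ->
  same_end v0 g h.
Proof.
move=> ub pg hp i M; have H := boundary_act_rep (h ^+ i)%g pg.
rewrite boundary_act_fixX // in H.
have [N HN] := proj1 (boundary_equivP hd o _ _) (boundary_rep_equiv hd H pg) M%:R.
exists N => n m Nn Nm; have := HN n m Nn Nm.
rewrite /gromov_product /= /orbit_seq /pt /conj_vertex -ext_conjM.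
rewrite -!/(conj_vertex v0 _) /d /ext_distR slen_conj_vertex -!/(slen v0 _) => K.
rewrite -(ler_nat R) !natrD; have M0 : 0 <= M%:R :> R by []; lra.
Qed.

Lemma common_end_power g h p : diverges g -> sval p (orbit_seq g) -> boundary_act h p = p ->
  exists i j j', (0 < i)%N /\ (h ^+ i = (g ^+ j)^-1 * g ^+ j')%g.
Proof.
move=> ub pg hp.
have gh := common_end ub pg hp.
have [i [j [j' [i0 E]]]] := same_end_power e_simple e_conn (diverges_unbounded_powers ub) gh.
by exists i, j, j'.
Qed.

Lemma diverges_pow g j : diverges g -> (0 < j)%N ->
  exists N, (slen v0 ((g ^+ j) ^+ N)%g != 0)%N.
Proof.
move=> ub j0; have [N HN] := ub 1%N; exists N; rewrite -expgnA -lt0n; apply: HN.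
by rewrite leq_pmull.
Qed.

(** A quotient of two different powers of g is a nontrivial power of g, so its
    own powers diverge. *)
Lemma diverges_quotient g j j' : diverges g ->
  (forall N, slen v0 (((g ^+ j)^-1 * g ^+ j') ^+ N)%g = 0%N) -> j = j'.
Proof.
move=> ub H; case: (ltngtP j j') => // lt.
- have [|N] := @diverges_pow g (j' - j) ub; first by rewrite subn_gt0.
  by have := H N; rewrite -{1}(subnKC (ltnW lt)) expgnDr mulKg => ->.
- have [|N] := @diverges_pow g^-1%g (j - j') (divergesV ub); first by rewrite subn_gt0.
  have := H N; rewrite -{1}(subnKC (ltnW lt)) expgnDr invgM mulgVK -expVgn => ->.
  by [].
Qed.

Lemma slen_gen_pow n : slen v0 ((gen v0 : G) ^+ n)%g = 0%N.
Proof.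
rewrite /slen; have -> : conj_vertex v0 ((gen v0 : G) ^+ n)%g = o; last exact: ext_distxx.
apply: val_inj; rewrite val_conj_vertex (conj_star e_simple) // => u /(occ_pow e_simple).
by rewrite (occ_gen e_simple); case: eqVneq.
Qed.

Lemma gen_pow_neq1 n : (0 < n)%N -> ((gen v0 : G) ^+ n)%g <> 1%g.
Proof.
move=> n0 E; have := len1 e_simple; rewrite -E (len_pow e_simple) ?(len_gen e_simple).
  by rewrite muln1 => n1; rewrite n1 in n0.
rewrite (rprod_letter e_simple); apply/negP => /(last_gen e_simple).
by [].
Qed.

(** If a power of the generator v0 fixed p then a further power of it would be a
    power of g; but it fixes the vertex v0, and is not trivial. *)
Lemma gen_moves_attractor g p n : diverges g -> sval p (orbit_seq g) -> (0 < n)%N ->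
  boundary_act ((gen v0 : G) ^+ n)%g p <> p.
Proof.
move=> ub pg n0 /(common_end_power ub pg)[i [j [j' [i0 E]]]].
have jj' : j = j'.
  by apply: (diverges_quotient ub) => N; rewrite -E -!expgnA slen_gen_pow.
apply: (@gen_pow_neq1 (n * i)); first by rewrite muln_gt0 n0.
by rewrite expgnA E jj' mulVg.
Qed.

(** The first and the second translate of p by the generator v0 differ from p and
    from each other, so one of them is not q. *)
Lemma third_point g p q : diverges g -> sval p (orbit_seq g) -> exists x : ext_boundary e R, x <> p /\ x <> q.
Proof.
move=> ub pg; have n1 := @gen_moves_attractor g p 1 ub pg isT.
have n2 := @gen_moves_attractor g p 2 ub pg isT.
have [E|] := pselect (boundary_act ((gen v0 : G) ^+ 1)%g p = q); last first.
  by exists (boundary_act ((gen v0 : G) ^+ 1)%g p).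
exists (boundary_act ((gen v0 : G) ^+ 2)%g p); split=> // E2; apply: n1.
apply: (@boundary_act_inj ((gen v0 : G) ^+ 1)%g).
by rewrite -boundary_actM E -E2 expg1 expg2.
Qed.

Lemma expgz_sub g (a b : nat) : expgz g (b%:Z - a%:Z) = ((g ^+ a)^-1 * g ^+ b)%g.
Proof.
case: (leqP a b) => ab.
  by rewrite subzn //= -{2}(subnKC ab) expgnDr mulKg.
have -> : b%:Z - a%:Z = Negz (a - b).-1 by lia.
rewrite /= prednK ?subn_gt0 // -{2}(subnKC (ltnW ab)) expgnDr invgM mulgVK.
by [].
Qed.

Lemma attractor_common_power g h p : diverges g -> diverges h -> sval p (orbit_seq g) ->
  boundary_act h p = p -> exists m n : int, [/\ m <> 0, n <> 0 & expgz g m = expgz h n].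
Proof.
move=> ubg ubh pg hp; have [i [j [j' [i0 E]]]] := common_end_power ubg pg hp.
exists (j'%:Z - j%:Z), i%:Z; split; last by rewrite expgz_sub -E.
  move=> jj'; have {}jj' : j = j' by lia.
  have [N] := diverges_pow ubh i0.
  by rewrite E jj' mulVg expg1n (slen1 v0).
by move=> i1; rewrite (_ : i = 0%N) in i0; [|lia].
Qed.

End Loxodromic.

Theorem lemma48 (R : realType) (V : finType) (e : rel V)
    (e_simple : simple_graph e) (e_conn : connected_graph e)
    (lam : raag e) (lam_lox : loxodromic R lam) :
  (exists pp pm : ext_boundary e R,
     [/\ pp <> pm,
         attracting_repelling lam pp pm &
         forall qp qm : ext_boundary e R,
           attracting_repelling lam qp qm -> qp = pp /\ qm = pm]) /\
  (forall lam' : raag e, loxodromic R lam' ->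
     (forall m n : int, m <> 0 -> n <> 0 -> expgz lam m <> expgz lam' n) ->
     forall p q : ext_boundary e R,
       boundary_act lam p = p -> boundary_act lam' q = q -> p <> q).
Proof.
have /card_gt0P[v0 _] := e_conn.1.
have ub := loxodromic_diverges v0 lam_lox; have ubV := divergesV e_simple e_conn ub.
have [pp ppE] := attractor_exists (R := R) e_simple e_conn ub.
have [pm pmE] := attractor_exists (R := R) e_simple e_conn ubV.
split.
  exists pp, pm; split.
  - exact: (poles_neq e_simple e_conn ub ppE pmE).
  - exact: (north_south e_simple e_conn ub ppE pmE).
  move=> qp qm; have [x [xpp xpm]] := third_point e_simple e_conn pm ub ppE.
  exact: (poles_unique e_simple e_conn ub ppE pmE xpp xpm).
move=> lam' lam'_lox no p q lam_p lam'_q pq.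
have ub' := loxodromic_diverges v0 lam'_lox; rewrite -pq in lam'_q.
case: (fixed_point e_simple e_conn ub ppE pmE lam_p) => pE; rewrite pE in lam'_q.
  have [m [n [m0 n0]]] := attractor_common_power e_simple e_conn ub ub' ppE lam'_q.
  exact: no.
have [m [n [m0 n0]]] := attractor_common_power e_simple e_conn ubV ub' pmE lam'_q.
have -> : expgz lam^-1%g m = expgz lam (- m) by case: m {m0} => [[|m]|m] //=; rewrite ?expVgn ?invgK.
by apply: no => //; lia.
Qed.
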